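(* A quantum spin system with $k$-body interactions fulfills Lieb-Robinson bounds in exponential form if and only if the underlying interactions decay exponentially in space, and for the ''only if'' direction it suffices to have the bounds for single-site observables. As a consequence, Lieb-Robinson bounds for single-site observables imply Lieb-Robinson bounds for observables with arbitrary support. Precisely: (a) (Exponential decay implies Lieb-Robinson bounds.) Given an exponentially decaying $k$-body potential, there exist constants $\mu,v,K>0$ such that for any finite $\Lambda\subset\mathbb{Z}^D$ and any $X,Y\subseteq\Lambda$, $$\max_{A\in\mathcal{A}_X,\,B\in\mathcal{A}_Y}\frac{\|[\tau^\Lambda_t(A),B]\|}{\|A\|\,\|B\|}\le 2\min\big\{1,\;g(t)\,\min\{|X|,|Y|\}\,K\,e^{-\mu d(X,Y)}\big\},$$ where $g(t)=e^{\mu v|t|}-1$ if $d(X,Y)>0$ and $g(t)=e^{\mu v|t|}$ if $d(X,Y)=0$. (b) (Single-site Lieb-Robinson bounds imply exponential decay.) Given a $k$-body potential, suppose there are constants $\mu,v,K>0$ such that for any finite $\Lambda\subset\mathbb{Z}^D$ and any two points $x\neq y$ in $\Lambda$, $$\max_{A\in\mathcal{A}_{\{x\}},\,B\in\mathcal{A}_{\{y\}}}\frac{\|[\tau^\Lambda_t(A),B]\|}{\|A\|\,\|B\|}\le K\,(e^{\mu v|t|}-1)\,e^{-\mu|x-y|}.$$ Then there are a constant $m_k$ depending only on $k$ and, for each such $\Lambda$, a $k$-body potential $\hat\Phi_\Lambda$ on $\Lambda$ giving rise to the same time-evolution $\tau^\Lambda_t$, with $$\|\hat\Phi_\Lambda(X)\|\le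 m_k\,\mu v K\,e^{-\mu\,\mathrm{diam}(X)}\qquad\text{for all }X\subseteq\Lambda\text{ with }|X|\ge2.$$ (c) (Side result.) For a system with $k$-body interactions, Lieb-Robinson bounds for single-site observables as in the hypothesis of (b) imply Lieb-Robinson bounds, of the form in (a), for observables with arbitrary support. No additional prefactor $d^{2|X|}$, as would come from expanding an observable on $X$ in a product operator basis, is needed.
   Context: Each site $x\in\mathbb{Z}^D$ carries a $d$-dimensional Hilbert space $\mathcal{H}_x$. For finite $X\subset\mathbb{Z}^D$, $\mathcal{H}_X=\bigotimes_{x\in X}\mathcal{H}_x$ and $\mathcal{A}_X=\mathcal{B}(\mathcal{H}_X)$; for $Y\subseteq X$, $\mathcal{A}_Y$ is embedded in $\mathcal{A}_X$ by tensoring with identities. $\|\cdot\|$ is the operator norm, $|x-y|$ is the graph distance on the lattice, $d(X,Y)$ is the distance between the regions $X$ and $Y$, $\mathrm{diam}(X)=\sup_{x,y\in X}|x-y|$, and $|X|$ is the number of sites in $X$. A potential $\Phi$ associates to each finite $X\subset\mathbb{Z}^D$ a bounded operator $\Phi(X)=\Phi(X)^\dagger\in\mathcal{A}_X$; a potential on $\Lambda$ is such an assignment for subsets $X\subseteq\Lambda$. It is $k$-body if $\Phi(X)=0$ whenever $|X|>k$ (this does not restrict the range of the interaction). It is exponentially decaying if there exist positive constants $K,a$ such that $\|\Phi(X)\|\le K e^{-a\,\mathrm{diam}(X)}$ for any region $X\subset\mathbb{Z}^D$. For finite $\Lambda$, $H_\Lambda=\sum_{X\subseteq\Lambda}\Phi(X)$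 and $\tau^\Lambda_t(A)=e^{iH_\Lambda t}Ae^{-iH_\Lambda t}$ for $A\in\mathcal{A}_\Lambda$. A potential $\hat\Phi_\Lambda$ on $\Lambda$ gives rise to $\tau^\Lambda_t$ if the Hamiltonian $\sum_{X\subseteq\Lambda}\hat\Phi_\Lambda(X)$ generates $\tau^\Lambda_t$ in this way. Since a given time-evolution can be generated by many different potentials, the question whether the interactions decay exponentially is understood as whether some exponentially decaying potential generates the same time-evolution. The maxima are over nonzero operators. Constants in different parts may differ. *)

(* Defs.v *)
From HB Require Import structures.
From mathcomp Require Import all_boot all_order all_algebra finmap complex.
From mathcomp Require Import all_classical all_reals all_analysis.

Set Implicit Arguments.
Unset Strict Implicit.
Unset Printing Implicit Defensive.

Import Order.TTheory GRing.Theory Num.Theory numFieldNormedType.Exports.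
Local Open Scope fset_scope.
Local Open Scope ring_scope.

Section Lattice.
Variable D : nat.

Definition site := {ffun 'I_D -> int}.

Definition adjacent (x y : site) : bool :=
  [exists i, (`|x i - y i|%N == 1%N) && [forall (j | j != i), x j == y j]].

Definition walk (x y : site) (n : nat) : Prop :=
  exists p : seq site, [/\ path adjacent x p, last x p = y & size p = n].

Local Definition l1 (x y : site) : nat := (\sum_i `|x i - y i|)%N.

Local Definition step (i : 'I_D) (e : int) (x : site) : site :=
  [ffun j => if j == i then x j + e else x j].

Local Lemma adjacent_step i (e : int) x : `|e|%N = 1%N -> adjacent x (step i e x).
Proof.
move=> e1; apply/existsP; exists i; rewrite ffunE eqxx opprD addNKr abszN e1.
by apply/forallP => j; apply/implyP => ji; rewrite ffunE (negPf ji).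
Qed.

Local Lemma walk_l1 x y : walk x y (l1 x y).
Proof.
move: {2}(l1 x y) (erefl (l1 x y)) => n; elim: n x => [|n IH] x lxy.
  exists [::]; split=> //=.
  apply/ffunP => i; apply/eqP; rewrite -subr_eq0 -absz_eq0 -leqn0 -lxy.
  by rewrite /l1 (bigD1 i) //= leq_addr.
have [i xyi] : exists i, x i != y i.
  apply: contrapT => /forallNP xy.
  move: lxy; rewrite /l1 big1 // => j _.
  by have /negP/negPn/eqP-> := xy j; rewrite subrr.
pose e : int := if x i < y i then 1 else -1.
have e1 : `|e|%N = 1%N by rewrite /e; case: ifP.
have lz : l1 (step i e x) y = n.
  apply: succn_inj; rewrite -lxy /l1 (bigD1 i) //= [in RHS](bigD1 i) //=.
  rewrite ffunE eqxx -addSn; congr (_ + _)%N; last first.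
    by apply: eq_bigr => j ji; rewrite ffunE (negPf ji).
  move: xyi; rewrite /e; case: ltrgtP => // [xy|xy] _.
    apply/eqP; rewrite -eqz_nat -addn1 PoszD !abszE.
    rewrite !ler0_norm; [|by rewrite subr_le0 ltW|
      by rewrite subr_le0 -ltzD1 ltrD2r].
    by rewrite !opprB opprD addrA subrK.
  apply/eqP; rewrite -eqz_nat -addn1 PoszD !abszE.
  rewrite !ger0_norm; [|by rewrite subr_ge0 ltW|
    by rewrite subr_ge0 -ltzD1 subrK].
  by rewrite addrAC subrK.
have [p [pp pl ps]] := IH _ lz.
exists (step i e x :: p); split=> //=; first by rewrite adjacent_step.
by rewrite ps lz.
Qed.

Fact walk_ex x y : exists n, `[< walk x y n >].
Proof. by exists (l1 x y); apply/asboolP/walk_l1. Qed.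

Definition gdist (x y : site) : nat := ex_minn (walk_ex x y).

Local Lemma l1_walk x y n : walk x y n -> (l1 x y <= n)%N.
Proof.
move=> [p [pp pl <-]]; elim: p x pp pl => [|z p IH] x /=.
  by move=> _ <-; rewrite /l1 big1 // => i _; rewrite subrr.
move=> /andP[/existsP[i /andP[/eqP xzi /forallP xz]] zp] zy.
rewrite (leq_trans _ (IH z zp zy : _ < _.+1)%N) //.
rewrite /l1 (bigD1 i) //= [in leqRHS](bigD1 i) //= -addSn.
rewrite (eq_bigr (fun j => `|z j - y j|)%N); last first.
  by move=> j ji; have /eqP-> := implyP (xz j) ji.
by rewrite leq_add2r -add1n -xzi leqD_dist.
Qed.

Lemma gdistE x y : gdist x y = (\sum_i `|x i - y i|)%N.
Proof.
rewrite /gdist; case: ex_minnP => n /asboolP/l1_walk nl lmin.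
by apply/eqP; rewrite eqn_leq nl lmin //; apply/asboolP/walk_l1.
Qed.

Definition diam (X : {fset site}) : nat :=
  \max_(x : X) \max_(y : X) gdist (val x) (val y).

(* The value is 0 when [X] or [Y] is empty, since [inf set0 = 0]. *)
Definition setdist (R : realType) (X Y : {fset site}) : R :=
  inf [set r : R | exists x y : site,
                   [/\ x \in X, y \in Y & r = (gdist x y)%:R]]%classic.

End Lattice.

Section Operators.
Variable R : realType.

Definition l2norm n (u : 'cV[R[i]]_n) : R :=
  Num.sqrt (\sum_(i < n) ComplexField.Normc.normc (u i 0) ^+ 2).

Definition opnorm n (A : 'M[R[i]]_n) : R :=
  sup [set l2norm (A *m u) | u in [set u | l2norm u <= 1]]%classic.

(* [R[i]^o] is [R[i]] with the topology of its absolute value. *)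
Definition mexp n (A : 'M[R[i]]_n) : 'M[R[i]]_n :=
  limn (series (fun k : nat => k`!%:R^-1 *: A ^+ k : 'M[R[i]^o]_n)).

Definition comm n (A B : 'M[R[i]]_n) : 'M[R[i]]_n := A *m B - B *m A.

Definition evol n (H : 'M[R[i]]_n) (t : R) (A : 'M[R[i]]_n) : 'M[R[i]]_n :=
  mexp (('i * t%:C)%C *: H) *m A *m mexp ((- ('i * t%:C))%C *: H).

End Operators.

Section SpinSystem.
Variables (R : realType) (D d : nat).
Implicit Types X Y Lam : {fset site D}.

(* The Hilbert space of a region [X] is the tensor product of [#|X|] copies of
   C^d, given by its product basis: the configurations [X -> 'I_d]. *)
Definition conf X : finType := {ffun X -> 'I_d}.

Definition op X := 'M[R[i]]_(#|conf X|).

Definition crestr X Lam (XL : X `<=` Lam) (s : conf Lam) : conf X :=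
  [ffun x => s (fincl XL x)].

Definition agree_off X Lam (s t : conf Lam) : bool :=
  [forall x : Lam, (val x \notin X) ==> (s x == t x)].

(* [A] tensored with the identity on the sites of [Lam] outside [X]. *)
Definition embed X Lam (XL : X `<=` Lam) (A : op X) : op Lam :=
  \matrix_(i, j)
    let s := enum_val i in let t := enum_val j in
    if agree_off X s t
    then A (enum_rank (crestr XL s)) (enum_rank (crestr XL t)) else 0.

Record potential := Potential {
  pot :> forall X, op X;
  pot_herm : forall X, pot X \is hermsymmx }.

Record potential_on Lam := PotentialOn {
  pot_on :> forall X : fpowerset Lam, op (val X);
  pot_on_herm : forall X : fpowerset Lam, pot_on X \is hermsymmx }.

Definition restrict (Phi : potential) Lam : potential_on Lam :=
  @PotentialOn Lam (fun X : fpowerset Lam => Phi (val X))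
    (fun X : fpowerset Lam => pot_herm Phi (val X)).

Fact fpowerset_sub Lam (X : fpowerset Lam) : val X `<=` Lam.
Proof. by rewrite -fpowersetE; exact: valP. Qed.

Definition hamiltonian Lam (Psi : potential_on Lam) : op Lam :=
  \sum_(X : fpowerset Lam) embed (fpowerset_sub X) (Psi X).

Definition kbody (k : nat) (Phi : potential) : Prop :=
  forall X, (k < #|` X|)%N -> Phi X = 0.

Definition kbody_on (k : nat) Lam (Psi : potential_on Lam) : Prop :=
  forall X : fpowerset Lam, (k < #|` val X|)%N -> Psi X = 0.

Definition exp_decaying (Phi : potential) : Prop :=
  exists K a : R, [/\ 0 < K, 0 < a &
    forall X, opnorm (Phi X) <= K * expR (- (a * (diam X)%:R))].

Definition tau (Phi : potential) Lam (t : R) : op Lam -> op Lam :=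
  evol (hamiltonian (restrict Phi Lam)) t.

Definition gives_rise Lam (Psi : potential_on Lam) (Phi : potential) : Prop :=
  forall (t : R) (A : op Lam), evol (hamiltonian Psi) t A = tau Phi t A.

(* The maximum over nonzero observables on [X] and [Y] of
   ||[tau_t(A), B]|| / (||A|| ||B||) is at most [c]. *)
Definition comm_bound (Phi : potential) Lam X Y
    (XL : X `<=` Lam) (YL : Y `<=` Lam) (t c : R) : Prop :=
  forall (A : op X) (B : op Y), A != 0 -> B != 0 ->
    opnorm (comm (tau Phi t (embed XL A)) (embed YL B)) /
      (opnorm A * opnorm B) <= c.

Definition LR_bounds (Phi : potential) (mu v K : R) : Prop :=
  forall Lam X Y (XL : X `<=` Lam) (YL : Y `<=` Lam) (t : R),
    let dXY := setdist R X Y in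
    let g := if 0 < dXY then expR (mu * v * `|t|) - 1
             else expR (mu * v * `|t|) in
    comm_bound Phi XL YL t
      (2 * Num.min 1 (g * (minn #|` X| #|` Y|)%:R * K * expR (- (mu * dXY)))).

Definition single_site_LR_bounds (Phi : potential) (mu v K : R) : Prop :=
  forall Lam (x y : site D)
    (xL : [fset x] `<=` Lam) (yL : [fset y] `<=` Lam) (t : R), x != y ->
    comm_bound Phi xL yL t
      (K * (expR (mu * v * `|t|) - 1) * expR (- (mu * (gdist x y)%:R))).

End SpinSystem.

(* Main.v *)
Require Import Defs.
From HB Require Import structures.
From mathcomp Require Import all_boot all_order all_algebra finmap complex.
From mathcomp Require Import all_classical all_reals all_analysis.
From mathcomp Require Import spectral sesquilinear ring lra zify.
Set Implicit Arguments.
Unset Strict Implicit.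
Unset Printing Implicit Defensive.
Import Order.TTheory GRing.Theory Num.Theory numFieldNormedType.Exports.
Local Open Scope sesquilinear_scope.
Local Open Scope fset_scope.
Local Open Scope ring_scope.

(** For (b), let [E_x] be the normalized partial trace over the site [x] and decompose
    [H] into the components [prod_(x in X) (1 - E_x) prod_(x notin X) E_x H].  They vanish
    for [#|X| > k].  As [E_x] averages conjugations by unitaries [U] on [x], and
    [H - U H U^* = [H, U] U^*], the component of [X] is bounded by [2 ^ k] times the
    largest [||[[H, U], V]||] with [U], [V] unitaries on two sites of [X] at distance
    [diam X]; the single-site bound differentiated at [t = 0] controls this double
    commutator.

    For (a), let [C_B(X, t)] be the supremum of [||[tau_t(A), B]||] over observables [A]
    on [X] of norm one.  Up to an error of order [e ^ 2],
    [C_B(X, t + e) <= C_B(X, t) + 2 e sum_Z ||Phi(Z)|| C_B(Z, t)], where [Z] ranges over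
    the regions that meet both [X] and its complement.  Comparison with the supersolution
    [2 ||B|| (w(X) (exp(2 s t) - 1) + 1_(X meets Y))], where
    [w(X) = sum_(x in X) exp(- mu d(x, Y))], gives the bound.  Such [Z] have at least two
    sites, so the potential of (b), whose one-site terms are not controlled, satisfies the
    same estimate, which is (c). *)

(** The comparison runs in discrete time steps, so no differentiability of [C_B] in time is
    required. The quadratic error of a step carries a constant that grows with the total interaction
    norm, hence with [Lam]; a slack [dl] absorbs it and tends to 0 with the step length, so that the
    final bound does not depend on the volume.

    The factor [exp(2 s t) - 1], rather than [exp(2 s t)], survives in the supersolution because the
    indicator that [Z] meets [Y] is at most [w(Z)]. It makes the bound vanish at time 0 for disjoint
    regions.

    The decay rate is halved. One half pays for moving the weight of a region to one of its sites,
    the other for the sum over all regions through that site, which is bounded uniformly in [Lam]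
    because the regions have boundedly many sites.

    The factor [min(#|X|, #|Y|)] comes from applying the estimate to [(X, Y)] and, with time
    reversed, to [(Y, X)]. *)

(** * Operator norm *)

HB.lock Definition onorm (R : realType) n (A : 'M[R[i]]_n) : R := opnorm A.

Section Norms.
Variable R : realType.
Local Notation C := R[i].
Local Notation normc := ComplexField.Normc.normc.

Lemma normC_normc (x : C) : `|x| = (normc x)%:C%C.
Proof. by []. Qed.

Lemma normc_ge0 (x : C) : 0 <= normc x.
Proof. by case: x => a b; rewrite sqrtr_ge0. Qed.

Definition nsq n (u : 'cV[C]_n) : R := \sum_(i < n) normc (u i 0) ^+ 2.

Lemma nsq_ge0 n (u : 'cV[C]_n) : 0 <= nsq u.
Proof. by apply: sumr_ge0 => i _; rewrite sqr_ge0. Qed.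

Lemma l2normE n (u : 'cV[C]_n) : l2norm u = Num.sqrt (nsq u).
Proof. by []. Qed.

Lemma l2norm_sqr n (u : 'cV[C]_n) : l2norm u ^+ 2 = nsq u.
Proof. by rewrite l2normE sqr_sqrtr ?nsq_ge0. Qed.

Lemma l2norm_ge0 n (u : 'cV[C]_n) : 0 <= l2norm u.
Proof. by rewrite sqrtr_ge0. Qed.

Lemma l2norm_le n m (u : 'cV[C]_n) (v : 'cV[C]_m) (c : R) :
  0 <= c -> (l2norm u <= c * l2norm v) = (nsq u <= c ^+ 2 * nsq v).
Proof.
move=> c0; rewrite -!l2norm_sqr -exprMn ler_pXn2r // ?nnegrE ?l2norm_ge0 //.
by rewrite mulr_ge0 ?l2norm_ge0.
Qed.

Lemma nsqC n (u : 'cV[C]_n) : (nsq u)%:C%C = (u ^t* *m u) 0 0.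
Proof.
rewrite /nsq rmorph_sum mxE; apply: eq_bigr => i _.
by rewrite !mxE rmorphXn /= -normC_normc normCK mulrC.
Qed.

Lemma nsqZ n (c : C) (u : 'cV[C]_n) : nsq (c *: u) = normc c ^+ 2 * nsq u.
Proof.
rewrite /nsq mulr_sumr; apply: eq_bigr => i _.
by rewrite mxE ComplexField.Normc.normcM exprMn.
Qed.

Lemma l2normZ n (c : C) (u : 'cV[C]_n) : l2norm (c *: u) = normc c * l2norm u.
Proof.
rewrite !l2normE nsqZ sqrtrM ?sqr_ge0 // sqrtr_sqr ger0_norm //.
exact: normc_ge0.
Qed.

Lemma l2norm0 n : l2norm (0 : 'cV[C]_n) = 0.
Proof. by rewrite -(scale0r 0) l2normZ ComplexField.Normc.normc0 mul0r. Qed.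

Lemma normc_le_l2norm n (u : 'cV[C]_n) j : normc (u j 0) <= l2norm u.
Proof.
rewrite -(@ler_pXn2r _ 2) // ?nnegrE ?l2norm_ge0 ?normc_ge0 // l2norm_sqr.
by rewrite /nsq (bigD1 j) //= lerDl sumr_ge0 // => i _; rewrite sqr_ge0.
Qed.

Lemma l2norm_eq0 n (u : 'cV[C]_n) : l2norm u = 0 -> u = 0.
Proof.
move=> u0; apply/matrixP => i j; rewrite ord1 mxE.
apply: ComplexField.Normc.eq0_normc; apply/le_anti; rewrite normc_ge0 andbT.
by rewrite -u0 normc_le_l2norm.
Qed.

Lemma l2normD n (u v : 'cV[C]_n) : l2norm (u + v) <= l2norm u + l2norm v.
Proof.
have [/l2norm_eq0->|u0] := eqVneq (l2norm u) 0; first by rewrite l2norm0 !add0r.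
have [/l2norm_eq0->|v0] := eqVneq (l2norm v) 0; first by rewrite l2norm0 !addr0.
have {u0}pu : 0 < l2norm u by rewrite lt_def u0 l2norm_ge0.
have {v0}pv : 0 < l2norm v by rewrite lt_def v0 l2norm_ge0.
rewrite -(@ler_pXn2r _ 2) // ?nnegrE ?addr_ge0 ?l2norm_ge0 // l2norm_sqr.
set p := l2norm u in pu *; set q := l2norm v in pv *.
(* AM-GM: |a + b|^2 <= (1 + q / p) |a|^2 + (1 + p / q) |b|^2 *)
have -> : (p + q) ^+ 2 = (1 + q / p) * nsq u + (1 + p / q) * nsq v.
  rewrite -!l2norm_sqr -/p -/q; field.
  by rewrite ?(gt_eqF pu) ?(gt_eqF pv).
rewrite /nsq !mulr_sumr -big_split /=; apply: ler_sum => i _.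
rewrite mxE; set a := u i 0; set b := v i 0.
apply: (@le_trans _ _ ((normc a + normc b) ^+ 2)).
  rewrite ler_pXn2r ?nnegrE ?addr_ge0 ?normc_ge0 //.
  exact: le_normcD.
move: (normc a) (normc b) => x y.
rewrite -subr_ge0 (_ : _ - _ = (q * x - p * y) ^+ 2 / (p * q)).
  by rewrite divr_ge0 ?sqr_ge0 // mulr_ge0 ?ltW.
field.
by rewrite ?(gt_eqF pu) ?(gt_eqF pv).
Qed.

Lemma l2norm_sum n (I : Type) (r : seq I) (P : pred I) (F : I -> 'cV[C]_n) :
  l2norm (\sum_(i <- r | P i) F i) <= \sum_(i <- r | P i) l2norm (F i).
Proof.
elim/big_ind2 : _ => [|x1 x2 y1 y2 h1 h2|//]; first by rewrite l2norm0.
by rewrite (le_trans (l2normD _ _)) // lerD.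
Qed.

(** [sup] is informative only for a nonempty bounded set. Expanding [A *m u] in the columns of [A]
    bounds it, as each coordinate of [u] is at most 1 in modulus. *)
Lemma opnorm_has_sup n (A : 'M[C]_n) :
  has_sup [set l2norm (A *m u) | u in [set u | l2norm u <= 1]]%classic.
Proof.
split; first by exists (l2norm (A *m 0)), 0 => //=; rewrite l2norm0 ler01.
exists (\sum_j l2norm (col j A)) => _ [u /= u1 <-].
have -> : A *m u = \sum_j u j 0 *: col j A.
  apply/matrixP => i k; rewrite ord1 mxE summxE; apply: eq_bigr => j _.
  by rewrite !mxE mulrC.
apply: le_trans (l2norm_sum _ _ _) _; apply: ler_sum => j _.
rewrite l2normZ ler_piMl ?l2norm_ge0 //.
exact: le_trans (normc_le_l2norm _ _) u1.
Qed.

Lemma onorm_le n (A : 'M[C]_n) (c : R) : 0 <= c ->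
  (forall u, l2norm (A *m u) <= c * l2norm u) -> onorm A <= c.
Proof.
move=> c0 Ac; rewrite onorm.unlock; apply: ge_sup; first by case: (opnorm_has_sup A).
move=> _ [u /= u1 <-]; apply: le_trans (Ac u) _.
by rewrite ler_piMr.
Qed.

Lemma onorm_ge0 n (A : 'M[C]_n) : 0 <= onorm A.
Proof.
rewrite onorm.unlock; apply: le_trans (ub_le_sup (proj2 (opnorm_has_sup A)) _).
  2: by exists 0 => //=; rewrite l2norm0 ler01.
exact: l2norm_ge0.
Qed.

Lemma l2norm_mul_le n (A : 'M[C]_n) u : l2norm (A *m u) <= onorm A * l2norm u.
Proof.
have [/l2norm_eq0->|u0] := eqVneq (l2norm u) 0.
  by rewrite mulmx0 l2norm0 mulr0.
have pu : 0 < l2norm u by rewrite lt_def u0 l2norm_ge0.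
rewrite onorm.unlock -ler_pdivrMr // mulrC.
have nV : normc (l2norm u)^-1%:C%C = (l2norm u)^-1.
  by rewrite /ComplexField.Normc.normc /= expr0n addr0 sqrtr_sqr ger0_norm
    ?invr_ge0 ?ltW.
rewrite -{1}nV -l2normZ scalemxAr; apply: (ub_le_sup (proj2 (opnorm_has_sup A))).
by eexists; [|reflexivity]; rewrite /= l2normZ nV mulVf.
Qed.

Lemma onorm0 n : onorm (0 : 'M[C]_n) = 0.
Proof.
apply/le_anti; rewrite onorm_ge0 andbT; apply: onorm_le => // u.
by rewrite mul0mx l2norm0 mul0r.
Qed.

Lemma onormD n (A B : 'M[C]_n) : onorm (A + B) <= onorm A + onorm B.
Proof.
apply: onorm_le => [|u]; first by rewrite addr_ge0 ?onorm_ge0.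
rewrite mulmxDl (le_trans (l2normD _ _)) // mulrDl.
by rewrite lerD ?l2norm_mul_le.
Qed.

Lemma onormM n (A B : 'M[C]_n) : onorm (A *m B) <= onorm A * onorm B.
Proof.
apply: onorm_le => [|u]; first by rewrite mulr_ge0 ?onorm_ge0.
rewrite -mulmxA (le_trans (l2norm_mul_le _ _)) // -mulrA.
by rewrite ler_wpM2l ?onorm_ge0 ?l2norm_mul_le.
Qed.

Lemma onormZ_le n (c : C) (A : 'M[C]_n) : onorm (c *: A) <= normc c * onorm A.
Proof.
apply: onorm_le => [|u]; first by rewrite mulr_ge0 ?normc_ge0 ?onorm_ge0.
by rewrite -scalemxAl l2normZ -mulrA ler_wpM2l ?normc_ge0 ?l2norm_mul_le.
Qed.

Lemma onormN n (A : 'M[C]_n) : onorm (- A) = onorm A.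
Proof.
have le B : onorm (- B) <= onorm (B : 'M[C]_n).
  by rewrite -scaleN1r (le_trans (onormZ_le _ _)) // normcN
    ComplexField.Normc.normc1 mul1r.
by apply/le_anti; rewrite le; have := le (- A); rewrite opprK.
Qed.

Lemma onormB n (A B : 'M[C]_n) : onorm (A - B) <= onorm A + onorm B.
Proof. by rewrite (le_trans (onormD _ _)) // onormN. Qed.

Lemma onorm_sum n (I : Type) (r : seq I) (P : pred I) (F : I -> 'M[C]_n) :
  onorm (\sum_(i <- r | P i) F i) <= \sum_(i <- r | P i) onorm (F i).
Proof.
elim/big_ind2 : _ => [|x1 x2 y1 y2 h1 h2|//]; first by rewrite onorm0.
by rewrite (le_trans (onormD _ _)) // lerD.
Qed.

Lemma onorm_gt0 n (A : 'M[C]_n) : A != 0 -> 0 < onorm A.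
Proof.
move=> A0; rewrite lt_def onorm_ge0 andbT; apply: contra A0 => /eqP A0.
apply/eqP/matrixP => i j; rewrite mxE; apply: ComplexField.Normc.eq0_normc.
apply/le_anti; rewrite normc_ge0 andbT.
have := l2norm_mul_le A (delta_mx j 0); rewrite A0 mul0r.
apply: le_trans; rewrite -colE.
by have := normc_le_l2norm (col j A) i; rewrite mxE.
Qed.

Lemma l2norm_unitary n (U : 'M[C]_n) u : U ^t* *m U = 1%:M ->
  l2norm (U *m u) = l2norm u.
Proof.
move=> UU; rewrite !l2normE; congr Num.sqrt; apply: complexI; rewrite !nsqC.
by rewrite trmx_mul map_mxM -mulmxA (mulmxA _ U) UU mul1mx.
Qed.

Lemma onorm_unitary n (U : 'M[C]_n) : U ^t* *m U = 1%:M -> onorm U <= 1.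
Proof. by move=> UU; apply: onorm_le => // u; rewrite l2norm_unitary ?mul1r. Qed.

Lemma onorm_diag n (v : 'rV[C]_n) (c : R) : 0 <= c ->
  (forall i, normc (v 0 i) <= c) -> onorm (diag_mx v) <= c.
Proof.
move=> c0 vc; apply: onorm_le => // u.
rewrite l2norm_le // /nsq mulr_sumr; apply: ler_sum => i _.
have -> : (diag_mx v *m u) i 0 = v 0 i * u i 0.
  by rewrite mul_diag_mx mxE.
rewrite ComplexField.Normc.normcM exprMn ler_wpM2r ?sqr_ge0 //.
by rewrite ler_pXn2r ?nnegrE ?normc_ge0.
Qed.

Lemma diag_le_onorm n (v : 'rV[C]_n) i : normc (v 0 i) <= onorm (diag_mx v).
Proof.
have := l2norm_mul_le (diag_mx v) (delta_mx i 0).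
have -> : l2norm (delta_mx i 0 : 'cV[C]_n) = 1.
  rewrite l2normE /nsq (bigD1 i) //= big1 => [|j ji].
    by rewrite mxE !eqxx ComplexField.Normc.normc1 expr1n addr0 sqrtr1.
  by rewrite mxE (negPf ji) ComplexField.Normc.normc0 expr0n.
rewrite mulr1; apply: le_trans.
by have := normc_le_l2norm (diag_mx v *m delta_mx i 0) i;
  rewrite mul_diag_mx !mxE !eqxx mulr1.
Qed.

Lemma onorm_conj n (U V A : 'M[C]_n) : onorm U <= 1 -> onorm V <= 1 ->
  onorm (U *m A *m V) <= onorm A.
Proof.
move=> U1 V1; apply: le_trans (onormM _ _) _.
rewrite -[leRHS]mulr1; apply: ler_pM => //; rewrite ?onorm_ge0 //.
apply: le_trans (onormM _ _) _.
by rewrite ler_piMl ?onorm_ge0.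
Qed.

Lemma commN n (A B : 'M[C]_n) : comm B A = - comm A B.
Proof. by rewrite /comm opprB. Qed.

Lemma onorm_comm n (A B : 'M[C]_n) :
  onorm (comm A B) <= 2 * onorm A * onorm B.
Proof.
apply: le_trans (onormB _ _) _; apply: le_trans (lerD (onormM _ _) (onormM _ _)) _.
by rewrite [onorm B * _]mulrC -mulr2n -mulrA mulr_natl.
Qed.

End Norms.

(** * Unitary groups of Hermitian matrices *)

Section Phase.
Variable R : realType.
Local Notation C := R[i].
Local Notation normc := ComplexField.Normc.normc.

(** The form of the mean value theorem that treats both signs of [x] at once. Applied repeatedly, it
    yields the crude Taylor bounds below. *)
Lemma mvt_from0 (f df : R -> R) (x : R) : (forall y : R, is_derive y (1 : R) f (df y)) ->
  exists2 c, `|c| <= `|x| & f x - f 0 = df c * x.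
Proof.
move=> fd.
have fc : continuous f.
  by move=> y; apply/differentiable_continuous/derivable1_diffP.
have [x0|/ltW x0] := leP 0 x.
  have [c] := MVT_segment x0 (fun y _ => fd y) (continuous_subspaceT fc).
  rewrite in_itv /= subr0 => /andP[c0 cx] ->; exists c => //.
  by rewrite !ger0_norm.
have [c] := MVT_segment x0 (fun y _ => fd y) (continuous_subspaceT fc).
rewrite in_itv /= sub0r => /andP[cx c0] fx; exists c.
  by rewrite !ler0_norm // lerN2.
by rewrite -opprB fx mulrN opprK.
Qed.

Lemma norm_sin_le (x : R) : `|sin x| <= `|x|.
Proof.
have [c _ /esym cx] := mvt_from0 x (@is_derive_sin R).
rewrite sin0 subr0 in cx; rewrite -cx normrM ler_piMl //.
by rewrite ler_norml cos_geN1 cos_le1.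
Qed.

Lemma norm_cosB1_le (x : R) : `|cos x - 1| <= `|x| ^+ 2.
Proof.
have [c cx /esym fx] := mvt_from0 x (@is_derive_cos R).
rewrite cos0 in fx; rewrite -fx normrM normrN expr2 ler_wpM2r //.
exact: le_trans (norm_sin_le c) cx.
Qed.

Lemma norm_cosB1_le1 (x : R) : `|cos x - 1| <= `|x|.
Proof.
have [c cx /esym fx] := mvt_from0 x (@is_derive_cos R).
rewrite cos0 in fx; rewrite -fx normrM normrN ler_piMl //.
by rewrite ler_norml sin_geN1 sin_le1.
Qed.

Lemma norm_sinB_le (x : R) : `|sin x - x| <= `|x| ^+ 2.
Proof.
have sd (y : R) : is_derive y (1 : R) (fun z : R => sin z - z) (cos y - 1).
  by apply: is_deriveB.
have [c cx /esym] := mvt_from0 x sd.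
rewrite sin0 !subr0 => <-; rewrite normrM expr2 ler_wpM2r //.
exact: le_trans (norm_cosB1_le1 c) cx.
Qed.

Definition phase (x : R) : C := (cos x +i* sin x)%C.

Lemma phase0 : phase 0 = 1.
Proof. by rewrite /phase cos0 sin0. Qed.

Lemma phaseD x y : phase (x + y) = phase x * phase y.
Proof. by rewrite /phase cosD sinD; congr (Complex _ _); rewrite addrC mulrC. Qed.

Lemma normc_phase x : normc (phase x) = 1.
Proof. by rewrite /= cos2Dsin2 sqrtr1. Qed.

Lemma conj_phase x : (phase x)^* = phase (- x).
Proof.
have px : phase x != 0.
  by apply/eqP => p0; have := normc_phase x; rewrite p0
    ComplexField.Normc.normc0 => /esym/eqP; rewrite oner_eq0.
apply: (mulfI px); rewrite -phaseD subrr phase0 -normCK normC_normc normc_phase.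
by rewrite expr1n.
Qed.

Lemma normc_phase_first x : normc (phase x - 1 - ('i * x%:C)%C) <= 2 * `|x| ^+ 2.
Proof.
have -> : phase x - 1 - ('i * x%:C)%C =
    (cos x - 1)%:C%C + 'i%C * (sin x - x)%:C%C.
  by apply/eqP; rewrite /phase eq_complex /=; apply/andP; split; apply/eqP; ring.
apply: le_trans (le_normcD _ _) _; rewrite ComplexField.Normc.normcM.
have nR (r : R) : normc r%:C%C = `|r| by rewrite /= expr0n addr0 sqrtr_sqr.
have -> : normc ('i%C : C) = 1 by rewrite /= expr0n add0r expr1n sqrtr1.
by rewrite !nR mul1r mulr_natl mulr2n lerD ?norm_cosB1_le ?norm_sinB_le.
Qed.

Lemma phase_term (x : R) k :
  k`!%:R^-1 * ('i * x%:C)%C ^+ k = (cos_coeff x k +i* sin_coeff x k)%C.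
Proof.
have ik : ('i%C : C) ^+ k = ((~~ odd k)%:R * (-1) ^+ k./2 +i*
                            ((odd k)%:R * (-1) ^+ k.-1./2))%C.
  rewrite -[in LHS](odd_double_half k) exprD -mul2n exprM sqr_i.
  have -> : (-1) ^+ k./2 = ((-1) ^+ k./2)%:C%C :> C by rewrite rmorphXn rmorphN1.
  case: (boolP (odd k)) => ok.
    have -> : k.-1./2 = k./2.
      by rewrite -[in LHS](odd_double_half k) ok /= doubleK.
    by apply/eqP; rewrite eq_complex /=; apply/andP; split; apply/eqP; ring.
  by apply/eqP; rewrite eq_complex /=; apply/andP; split; apply/eqP; ring.
rewrite exprMn ik -rmorphXn /=.
have -> : (k`!%:R^-1 : C) = (k`!%:R^-1 : R)%:C%C.
  by rewrite fmorphV rmorph_nat.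
rewrite /cos_coeff /sin_coeff /= -exprnP; move: (_^-1 : R) => r.
by apply/eqP; rewrite eq_complex /=; apply/andP; split; apply/eqP; ring.
Qed.

Lemma cvg_complex (a b : nat -> R) (la lb : R) :
  (a @ \oo --> la)%classic -> (b @ \oo --> lb)%classic ->
  ((fun n => (a n +i* b n)%C : C^o) @ \oo --> ((la +i* lb)%C : C^o))%classic.
Proof.
move=> /cvgrPdist_le ca /cvgrPdist_le cb; apply/cvgrPdist_le => e e0.
(* Radii of balls in [C] are themselves complex numbers; positivity makes them real. *)
have [r er] : exists r, e = r%:C%C.
  by have /complex_realP[r ->] := gtr0_real e0; exists r.
have r0 : 0 < r / 2 by rewrite divr_gt0 // -ltcR -er.
have {}ca := ca _ r0; have {}cb := cb _ r0; near=> n.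
rewrite er.
have -> : ((la +i* lb)%C : C^o) - (a n +i* b n)%C =
    (la - a n)%:C%C + 'i%C * (lb - b n)%:C%C.
  by apply/eqP; rewrite eq_complex /=; apply/andP; split; apply/eqP; ring.
change (`|(la - a n)%:C%C + 'i%C * (lb - b n)%:C%C : C| <= r%:C%C).
rewrite normC_normc lecR; apply: le_trans (le_normcD _ _) _.
rewrite ComplexField.Normc.normcM.
have nR (s : R) : normc s%:C%C = `|s| by rewrite /= expr0n addr0 sqrtr_sqr.
have -> : normc ('i%C : C) = 1 by rewrite /= expr0n add0r expr1n sqrtr1.
rewrite !nR mul1r [leRHS]splitr lerD //.
  by near: n.
by near: n.
Unshelve. all: by end_near.
Qed.

Lemma cvg_phase (x : R) :
  ((fun n => \sum_(0 <= k < n) k`!%:R^-1 * ('i * x%:C)%C ^+ k : C^o) @ \oo -->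
    (phase x : C^o))%classic.
Proof.
rewrite /phase; have := @is_cvg_series_cos_coeff _ x.
have := @is_cvg_series_sin_coeff _ x.
rewrite cos.unlock sin.unlock => cs cc.
rewrite (_ : (fun n => _) = fun n => (series (cos_coeff x) n +i* series (sin_coeff x) n)%C).
  exact: cvg_complex.
apply/funext => n; rewrite /series /=; elim: n => [|n IH].
  by rewrite !big_geq.
by rewrite !big_nat_recr //= phase_term IH.
Qed.

Lemma cvg_sum_phase m (a : 'I_m -> C) (x : 'I_m -> R) :
  ((fun n => (\sum_l a l * \sum_(0 <= k < n) k`!%:R^-1 * ('i * (x l)%:C)%C ^+ k : C)
      : C^o) @ \oo -->
    ((\sum_l a l * phase (x l) : C) : C^o))%classic.
Proof.
(* The summand 1 keeps [S] positive when all coefficients vanish. *)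
apply/cvgrPdist_le => e e0; pose S : C := 1 + \sum_l `|a l|.
have S0 : 0 < S by rewrite ltr_wpDr ?sumr_ge0.
have cx : \forall n \near \oo%classic, forall l, `|phase (x l) -
    \sum_(0 <= k < n) k`!%:R^-1 * ('i * (x l)%:C)%C ^+ k| <= e / S.
  apply: filter_forall => l; have /cvgrPdist_le := @cvg_phase (x l).
  by apply; rewrite divr_gt0.
near=> n.
have cxn : forall l, `|phase (x l) -
    \sum_(0 <= k < n) k`!%:R^-1 * ('i * (x l)%:C)%C ^+ k| <= e / S by near: n.
change (`|\sum_l a l * phase (x l) - \sum_l a l *
  \sum_(0 <= k < n) k`!%:R^-1 * ('i * (x l)%:C)%C ^+ k : C| <= e).
rewrite -sumrB; apply: le_trans (ler_norm_sum _ _ _) _.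
apply: (@le_trans _ _ (\sum_l `|a l| * (e / S))).
  by apply: ler_sum => l _; rewrite -mulrBr normrM ler_wpM2l.
rewrite -mulr_suml mulrCA ler_piMr ?(ltW e0) // ler_pdivrMr // mul1r.
by rewrite lerDr ler01.
Unshelve. all: by end_near.
Qed.

Lemma cvg_mx_entries (T : Type) (F : set_system T) (FF : Filter F) m n
    (f : T -> 'M[C^o]_(m, n)) (l : 'M[C^o]_(m, n)) :
  (forall i j, ((fun x => f x i j) @ F --> l i j)%classic) ->
  (f @ F --> l)%classic.
Proof.
move=> fl; apply/cvg_ballP => e e0.
have fij : \forall x \near F, forall ij : 'I_m * 'I_n,
    ball (l ij.1 ij.2) e (f x ij.1 ij.2).
  by apply: filter_forall => ij; move/cvg_ballP: (fl ij.1 ij.2); exact.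
near=> x; split=> // i j.
by have : forall ij : 'I_m * 'I_n, ball (l ij.1 ij.2) e (f x ij.1 ij.2) by [near: x|];
  move=> /(_ (i, j)).
Unshelve. all: by end_near.
Qed.

End Phase.

(** * Functions of a matrix in a fixed unitary eigenbasis *)

HB.lock Definition diag_conj (R : realType) n (P : 'M[R[i]]_n) (u : 'rV[R[i]]_n) : 'M[R[i]]_n :=
  P ^t* *m diag_mx u *m P.

Section DiagConj.
Variables (R : realType) (n : nat).
Local Notation C := R[i].
Local Notation normc := ComplexField.Normc.normc.
Implicit Types (P X Y : 'M[C]_n) (u v : 'rV[C]_n).

Lemma mulmx_conj P X Y : P *m P ^t* = 1%:M ->
  (P ^t* *m X *m P) *m (P ^t* *m Y *m P) = P ^t* *m (X *m Y) *m P.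
Proof.
move=> PP; have -> : P ^t* *m X *m P *m (P ^t* *m Y *m P) =
  P ^t* *m X *m (P *m P ^t*) *m Y *m P by rewrite !mulmxA.
by rewrite PP mulmx1 !mulmxA.
Qed.

Lemma diag_conjM P u v : P *m P ^t* = 1%:M ->
  diag_conj P u *m diag_conj P v = diag_conj P (\row_j (u 0 j * v 0 j)).
Proof. by move=> PP; rewrite diag_conj.unlock (mulmx_conj _ _ PP) mulmx_diag. Qed.

Lemma diag_conj1 P : P ^t* *m P = 1%:M -> diag_conj P (const_mx 1) = 1%:M.
Proof. by move=> PP; rewrite diag_conj.unlock diag_const_mx mulmx1 PP. Qed.

Lemma diag_conj_adj P u : (diag_conj P u)^t* = diag_conj P (map_mx Num.conj u).
Proof.
by rewrite diag_conj.unlock !trmx_mul !map_mxM trmxCK mulmxA tr_diag_mx map_diag_mx.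
Qed.

Lemma diag_conjZ P c u : c *: diag_conj P u = diag_conj P (c *: u).
Proof. by rewrite diag_conj.unlock scalemxAl scalemxAr -linearZ. Qed.

Lemma diag_conjB P u v : diag_conj P u - diag_conj P v = diag_conj P (u - v).
Proof. by rewrite diag_conj.unlock linearB /= mulmxBr mulmxBl. Qed.

Lemma diag_conjE P u i j : diag_conj P u i j = \sum_l P ^t* i l * P l j * u 0 l.
Proof.
rewrite diag_conj.unlock mxE; apply: eq_bigr => l _.
by rewrite mul_mx_diag !mxE mulrAC.
Qed.

Lemma diag_conjK P u : P *m P ^t* = 1%:M -> P *m diag_conj P u *m P ^t* = diag_mx u.
Proof. by move=> PP; rewrite diag_conj.unlock !mulmxA PP mul1mx -mulmxA PP mulmx1. Qed.

Lemma onorm_diag_conj P u c : P ^t* *m P = 1%:M -> P *m P ^t* = 1%:M -> 0 <= c ->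
  (forall i, normc (u 0 i) <= c) -> onorm (diag_conj P u) <= c.
Proof.
move=> P1 P2 c0 uc; rewrite diag_conj.unlock; apply: le_trans (onorm_conj _ _ _) _.
- by apply: onorm_unitary; rewrite trmxCK.
- exact: onorm_unitary.
exact: onorm_diag.
Qed.

(** In the eigenbasis, commuting with [u] means that the entry [(i, j)] of [W] vanishes unless
    [u 0 i = u 0 j]; any function [v] of [u] then commutes as well. *)
Lemma diag_conj_comm P u v W : P ^t* *m P = 1%:M -> P *m P ^t* = 1%:M ->
  (forall i j, u 0 i = u 0 j -> v 0 i = v 0 j) ->
  diag_conj P u *m W = W *m diag_conj P u -> diag_conj P v *m W = W *m diag_conj P v.
Proof.
move=> P1 P2 uv uW; pose Y := P *m W *m P ^t*.
have inj X Z : P *m X *m P ^t* = P *m Z *m P ^t* -> X = Z.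
  move=> /(congr1 (fun V => P ^t* *m V *m P)).
  by rewrite !mulmxA P1 !mul1mx -!mulmxA P1 !mulmx1.
have EL w : P *m (diag_conj P w *m W) *m P ^t* = diag_mx w *m Y.
  by rewrite -(diag_conjK w P2) /Y -!mulmxA (mulmxA (P ^t*) P) P1 mul1mx.
have ER w : P *m (W *m diag_conj P w) *m P ^t* = Y *m diag_mx w.
  by rewrite -(diag_conjK w P2) /Y -!mulmxA (mulmxA (P ^t*) P) P1 mul1mx.
apply: inj; rewrite EL ER.
have {uW} /matrixP uY : diag_mx u *m Y = Y *m diag_mx u by rewrite -EL -ER uW.
apply/matrixP => i j; have := uY i j.
rewrite !mul_diag_mx !mul_mx_diag !mxE mulrC => /eqP.
rewrite -subr_eq0 -mulrBr mulf_eq0 => /orP[/eqP->|]; first by rewrite mulr0 mul0r.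
by rewrite subr_eq0 mulrC => /eqP/uv ->.
Qed.

End DiagConj.

Section Exponential.
Variables (R : realType) (n : nat).
Local Notation C := R[i].
Local Notation normc := ComplexField.Normc.normc.
Implicit Types (H A W P : 'M[C]_n) (s t : R).

Definition eigval H (j : 'I_n) : R := complex.Re (spectral_diag H 0 j).

Lemma spectral_adjK H : (spectralmx H)^t* *m spectralmx H = 1%:M.
Proof.
by rewrite -(invmx_unitary (spectral_unitarymx H)) mulVmx ?spectral_unit.
Qed.

Lemma spectral_Kadj H : spectralmx H *m (spectralmx H)^t* = 1%:M.
Proof. by apply/unitarymxP/spectral_unitarymx. Qed.

(** For Hermitian [H] this is [exp(i t H)], see [mexp_herm]. The spectral form reduces the group
    law, unitarity and Taylor bounds to scalar statements about [phase]. *)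
Definition expU H t : 'M[C]_n :=
  diag_conj (spectralmx H) (\row_j phase (t * eigval H j)).

Lemma herm_spectral H : H \is hermsymmx ->
  H = diag_conj (spectralmx H) (\row_j (eigval H j)%:C%C).
Proof.
move=> hH; have /orthomx_spectralP {1}-> := hermitian_normalmx hH.
rewrite diag_conj.unlock (invmx_unitary (spectral_unitarymx H)).
rewrite (_ : spectral_diag H = \row_j (eigval H j)%:C%C); first by [].
apply/rowP => j; rewrite mxE RRe_real; first by [].
by have /mxOverP := hermitian_spectral_diag_real hH; apply.
Qed.

Lemma expU0 H : expU H 0 = 1%:M.
Proof.
rewrite /expU (_ : (\row_j _) = const_mx 1); last first.
  by apply/rowP => j; rewrite !mxE mul0r phase0.
exact: diag_conj1 (spectral_adjK H).
Qed.

Lemma expUD H s t : expU H s *m expU H t = expU H (s + t).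
Proof.
rewrite /expU (diag_conjM _ _ (spectral_Kadj H)); congr (diag_conj _ _).
by apply/rowP => j; rewrite !mxE mulrDl phaseD.
Qed.

Lemma expU_adj H t : (expU H t)^t* = expU H (- t).
Proof.
rewrite /expU diag_conj_adj; congr (diag_conj _ _).
apply/rowP => j; rewrite !mxE mulNr -conj_phase; exact: erefl.
Qed.

Lemma expU_unitary H t : (expU H t)^t* *m expU H t = 1%:M.
Proof. by rewrite expU_adj expUD addNr expU0. Qed.

Lemma onorm_expU H t : onorm (expU H t) <= 1.
Proof. exact: onorm_unitary (expU_unitary H t). Qed.

Lemma expU_comm H W t : H \is hermsymmx -> H *m W = W *m H ->
  expU H t *m W = W *m expU H t.
Proof.
move=> /herm_spectral {1 2}->.
apply: diag_conj_comm; [exact: spectral_adjK|exact: spectral_Kadj|].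
by move=> i j; rewrite !mxE => -[->].
Qed.

Lemma eigval_le H j : H \is hermsymmx -> `|eigval H j| <= onorm H.
Proof.
move=> hH; have := diag_le_onorm (\row_j (eigval H j)%:C%C) j.
rewrite mxE /= expr0n addr0 sqrtr_sqr => /le_trans; apply.
rewrite -(diag_conjK _ (spectral_Kadj H)) -(herm_spectral hH).
apply: onorm_conj; apply: onorm_unitary; last by rewrite trmxCK spectral_Kadj.
exact: spectral_adjK.
Qed.

Lemma expU_first H t : H \is hermsymmx ->
  onorm (expU H t - 1%:M - ('i * t%:C)%C *: H) <= 2 * t ^+ 2 * onorm H ^+ 2.
Proof.
move=> hH; rewrite [in X in _ - X](herm_spectral hH) -(diag_conj1 (spectral_adjK H)).
rewrite diag_conjZ !diag_conjB.
apply: onorm_diag_conj; [exact: spectral_adjK|exact: spectral_Kadj|..].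
  by rewrite mulr_ge0 ?sqr_ge0 // mulr_ge0 ?sqr_ge0.
move=> j; rewrite !mxE.
rewrite (_ : ('i * t%:C)%C * _ = ('i * (t * eigval H j)%:C)%C); last first.
  by rewrite rmorphM mulrA.
apply: le_trans (normc_phase_first _) _.
rewrite -mulrA ler_pM2l // -exprMn -[leRHS]real_normK ?num_real //.
rewrite ler_pXn2r // ?nnegrE //.
by rewrite !normrM (ger0_norm (onorm_ge0 H)) ler_wpM2l ?eigval_le.
Qed.

(** In the eigenbasis each matrix entry of the exponential series is a fixed finite combination of
    scalar exponential series, so entrywise convergence is [cvg_sum_phase]. *)
Lemma mexp_herm H t : H \is hermsymmx -> mexp (('i * t%:C)%C *: H) = expU H t.
Proof.
move=> hH; set P := spectralmx H; set c := ('i * t%:C)%C.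
have powE k : (c *: H) ^+ k =
    diag_conj P (\row_j (('i * (t * eigval H j)%:C)%C ^+ k)).
  elim: k => [|k IH].
    rewrite expr0 (_ : (\row_j _) = const_mx 1); last first.
      by apply/rowP => j; rewrite !mxE expr0.
    by rewrite (diag_conj1 (spectral_adjK H)).
  rewrite exprS IH {1}(herm_spectral hH) diag_conjZ -mulmxE.
  rewrite (diag_conjM _ _ (spectral_Kadj H)); congr (diag_conj _ _).
  by apply/rowP => j; rewrite !mxE exprS rmorphM mulrA.
rewrite /mexp; apply: (@cvg_lim 'M[C^o]_n); first exact: norm_hausdorff.
apply: cvg_mx_entries => i j.
have serE N : series (fun k : nat => k`!%:R^-1 *: (c *: H) ^+ k : 'M[C^o]_n) N i j =
    \sum_l P ^t* i l * P l j *
      \sum_(0 <= k < N) k`!%:R^-1 * ('i * (t * eigval H l)%:C)%C ^+ k.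
  rewrite /series /= summxE.
  transitivity (\sum_(0 <= k < N) \sum_l
      k`!%:R^-1 * (P ^t* i l * P l j * ('i * (t * eigval H l)%:C)%C ^+ k)).
    apply: eq_bigr => k _; transitivity (k`!%:R^-1 * ((c *: H) ^+ k) i j).
      by rewrite mxE.
    rewrite powE diag_conjE mulr_sumr; apply: eq_bigr => l _.
    by rewrite [(\row__ _) _ _]mxE.
  rewrite exchange_big /=; apply: eq_bigr => l _; rewrite mulr_sumr.
  by apply: eq_bigr => k _; rewrite mulrCA.
have conv := @cvg_sum_phase _ _ (fun l => P ^t* i l * P l j) (fun l => t * eigval H l).
have <- : \sum_l P ^t* i l * P l j * phase (t * eigval H l) = expU H t i j.
  by rewrite /expU diag_conjE; under [in RHS]eq_bigr do rewrite [(\row__ _) _ _]mxE.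
move: conv; rewrite -(funext serE).
done.
Qed.

Lemma evolE H t A : H \is hermsymmx ->
  evol H t A = expU H t *m A *m expU H (- t).
Proof.
move=> hH; rewrite /evol (mexp_herm t hH); congr (_ *m _).
by rewrite -(mexp_herm (- t) hH) rmorphN mulrN.
Qed.

End Exponential.

(** * First-order expansion of the Heisenberg evolution *)

Section FirstOrder.
Variables (R : realType) (n : nat).
Local Notation C := R[i].
Local Notation normc := ComplexField.Normc.normc.
Implicit Types (H A B V : 'M[C]_n) (s t h : R).

Definition heis H t A : 'M[C]_n := expU H t *m A *m expU H (- t).

Lemma normc_it t : normc ('i * t%:C)%C = `|t|.
Proof.
rewrite ComplexField.Normc.normcM /= !expr0n /= expr1n add0r addr0 sqrtr1 mul1r.
by rewrite sqrtr_sqr.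
Qed.

Lemma onorm_it t A : onorm (('i * t%:C)%C *: A) <= `|t| * onorm A.
Proof. by apply: le_trans (onormZ_le _ _) _; rewrite normc_it. Qed.

Lemma onorm_heis H t A : onorm (heis H t A) <= onorm A.
Proof. by apply: onorm_conj; apply: onorm_expU. Qed.

Lemma heisD H t A B : heis H t (A + B) = heis H t A + heis H t B.
Proof. by rewrite /heis mulmxDr mulmxDl. Qed.

Lemma heisB H t A B : heis H t (A - B) = heis H t A - heis H t B.
Proof. by rewrite /heis mulmxBr mulmxBl. Qed.

Lemma heisZ H t c A : heis H t (c *: A) = c *: heis H t A.
Proof. by rewrite /heis -scalemxAr -scalemxAl. Qed.

Lemma heis_sum H t (I : finType) (P : pred I) (F : I -> 'M[C]_n) :
  heis H t (\sum_(i | P i) F i) = \sum_(i | P i) heis H t (F i).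
Proof. by rewrite /heis mulmx_sumr mulmx_suml. Qed.

Lemma expUK H t : expU H (- t) *m expU H t = 1%:M.
Proof. by rewrite expUD addNr expU0. Qed.

Lemma expUVK H t : expU H t *m expU H (- t) = 1%:M.
Proof. by rewrite expUD subrr expU0. Qed.

Lemma heisM H t A B : heis H t (A *m B) = heis H t A *m heis H t B.
Proof.
rewrite /heis -[_ *m (_ *m B *m _)]mulmxA [expU H (- t) *m _]mulmxA.
by rewrite [expU H (- t) *m _]mulmxA expUK mul1mx !mulmxA.
Qed.

Lemma heis1 H t : heis H t 1%:M = 1%:M.
Proof. by rewrite /heis mulmx1 expUVK. Qed.

Lemma heis_add H s t A : heis H (s + t) A = heis H s (heis H t A).
Proof.
by rewrite /heis opprD (addrC (- s)) -!expUD !mulmxA.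
Qed.

Lemma heis0 H A : heis H 0 A = A.
Proof. by rewrite /heis oppr0 expU0 mul1mx mulmx1. Qed.

Lemma commDl A1 A2 B : comm (A1 + A2) B = comm A1 B + comm A2 B.
Proof. by rewrite /comm mulmxDl mulmxDr opprD addrACA. Qed.

Lemma commBl A1 A2 B : comm (A1 - A2) B = comm A1 B - comm A2 B.
Proof. by rewrite /comm mulmxBl mulmxBr !opprB addrACA [RHS]addrACA [- (A2 *m B) - _]addrC. Qed.

Lemma commDr A B1 B2 : comm A (B1 + B2) = comm A B1 + comm A B2.
Proof. by rewrite !(commN _ A) commDl opprD. Qed.

Lemma commBr A B1 B2 : comm A (B1 - B2) = comm A B1 - comm A B2.
Proof. by rewrite !(commN _ A) commBl opprB opprK addrC. Qed.

Lemma commZl c A B : comm (c *: A) B = c *: comm A B.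
Proof. by rewrite /comm -scalemxAl -scalemxAr -scalerBr. Qed.

Lemma comm_suml (I : finType) (P : pred I) (F : I -> 'M[C]_n) B :
  comm (\sum_(i | P i) F i) B = \sum_(i | P i) comm (F i) B.
Proof. by rewrite /comm mulmx_suml mulmx_sumr -sumrB. Qed.

Lemma comm1l B : comm 1%:M B = 0.
Proof. by rewrite /comm mul1mx mulmx1 subrr. Qed.

Lemma heis_comm H t A B : heis H t (comm A B) = comm (heis H t A) (heis H t B).
Proof. by rewrite /comm heisB !heisM. Qed.

(** The three terms of [first_order_expand] contribute [2 h^2], [2 h^2] and [h (2 h^2 + h)]. *)
Definition first_order_const h : R := 5 * h ^+ 2 + 2 * h ^+ 3.

Lemma first_order_const_ge0 h : 0 <= h -> 0 <= first_order_const h.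
Proof. by move=> h0; rewrite addr_ge0 // mulr_ge0 // exprn_ge0. Qed.

(** Each summand on the right is of second order: the first two contain the Taylor remainder of [E]
    or [E'], the third is a product of two first-order factors. *)
Lemma first_order_expand (E E' A H : 'M[C]_n) (a : C) :
  E *m A *m E' - A - a *: comm H A =
  (E - 1%:M - a *: H) *m A *m E' + A *m (E' - 1%:M + a *: H) +
  a *: H *m A *m (E' - 1%:M).
Proof.
have -> : (E - 1%:M - a *: H) *m A *m E' = E *m A *m E' - A *m E' - a *: (H *m A *m E').
  by rewrite !mulmxBl mul1mx -!scalemxAl.
have -> : A *m (E' - 1%:M + a *: H) = A *m E' - A + a *: (A *m H).
  by rewrite mulmxDr mulmxBr mulmx1 -scalemxAr.
have -> : a *: H *m A *m (E' - 1%:M) = a *: (H *m A *m E') - a *: (H *m A).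
  by rewrite mulmxBr mulmx1 -!scalemxAl.
rewrite /comm.
move: (E *m A *m E') (A *m E') (H *m A *m E') (H *m A) (A *m H) => p q s w z.
by apply/matrixP => i j; rewrite !mxE; ring.
Qed.

Lemma heis_first H t A h : H \is hermsymmx -> onorm H <= h -> `|t| <= 1 ->
  onorm (heis H t A - A - ('i * t%:C)%C *: comm H A) <=
    first_order_const h * t ^+ 2 * onorm A.
Proof.
move=> hH Hh t1; have h0 : 0 <= h := le_trans (onorm_ge0 H) Hh.
have A0 := onorm_ge0 A.
set a := ('i * t%:C)%C; set E := expU H t; set E' := expU H (- t).
pose r := E - 1%:M - a *: H; pose r' := E' - 1%:M + a *: H.
have h2 : onorm H ^+ 2 <= h ^+ 2 by rewrite ler_pXn2r ?nnegrE ?onorm_ge0.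
have rn : onorm r <= 2 * t ^+ 2 * h ^+ 2.
  by apply: le_trans (expU_first t hH) _; rewrite ler_wpM2l // mulr_ge0 ?sqr_ge0.
have r'n : onorm r' <= 2 * t ^+ 2 * h ^+ 2.
  have -> : r' = E' - 1%:M - ('i * (- t)%:C)%C *: H.
    by rewrite /r' rmorphN mulrN scaleNr opprK.
  apply: le_trans (expU_first (- t) hH) _; rewrite sqrrN ler_wpM2l //.
  by rewrite mulr_ge0 ?sqr_ge0.
have aH : onorm (a *: H) <= `|t| * h.
  by apply: le_trans (onorm_it _ _) _; rewrite ler_wpM2l.
have t2 : t ^+ 2 = `|t| * `|t| by rewrite -expr2 real_normK ?num_real.
have E'1 : onorm (E' - 1%:M) <= `|t| * (2 * h ^+ 2 + h).
  have -> : E' - 1%:M = r' - a *: H by rewrite /r' addrK.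
  apply: le_trans (onormB _ _) _; apply: le_trans (lerD r'n aH) _.
  rewrite t2 mulrDr lerD2r mulrAC [leRHS]mulrC ler_wpM2l ?mulr_ge0 ?sqr_ge0 //.
  by rewrite ler_piMl.
have E'n : onorm E' <= 1 by apply: onorm_expU.
rewrite (first_order_expand E E' A H a).
apply: le_trans (onormD _ _) _; apply: le_trans (lerD (onormD _ _) (lexx _)) _.
have n1 : onorm (r *m A *m E') <= 2 * t ^+ 2 * h ^+ 2 * onorm A.
  apply: le_trans (onormM _ _) _; rewrite -[leRHS]mulr1.
  apply: ler_pM; rewrite ?onorm_ge0 //; apply: le_trans (onormM _ _) _.
  by rewrite ler_wpM2r.
have n2 : onorm (A *m r') <= 2 * t ^+ 2 * h ^+ 2 * onorm A.
  by apply: le_trans (onormM _ _) _; rewrite mulrC ler_wpM2r.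
have n3 : onorm (a *: H *m A *m (E' - 1%:M)) <=
    `|t| * h * onorm A * (`|t| * (2 * h ^+ 2 + h)).
  apply: le_trans (onormM _ _) _; apply: ler_pM; rewrite ?onorm_ge0 //.
  by apply: le_trans (onormM _ _) _; rewrite ler_wpM2r.
apply: le_trans (lerD (lerD n1 n2) n3) _.
rewrite /first_order_const t2 le_eqVlt; apply/orP; left; apply/eqP; ring.
Qed.

(** Three first-order remainders, and the cross term [[H2, A1 - A]] of [heis_split]. *)
Definition second_order_const h : R :=
  3 * first_order_const h + 2 * h * (first_order_const h + 2 * h).

(** A Trotter splitting: both sides have the same first-order term [[H1 + H2, A]], because [H3]
    commutes with [A]. The remaining discrepancy is that [H2] acts on the evolved [A1] instead of
    [A]. *)
Lemma heis_split H H1 H2 H3 t A h :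
  H \is hermsymmx -> H1 \is hermsymmx -> H2 \is hermsymmx ->
  H = H1 + H2 + H3 -> comm H3 A = 0 ->
  onorm H <= h -> onorm H1 <= h -> onorm H2 <= h -> `|t| <= 1 ->
  onorm (heis H t A - heis H2 t (heis H1 t A)) <=
    second_order_const h * t ^+ 2 * onorm A.
Proof.
move=> hH hH1 hH2 HE H3A Hh H1h H2h t1.
have h0 : 0 <= h := le_trans (onorm_ge0 H) Hh; have A0 := onorm_ge0 A.
have t2 : t ^+ 2 = `|t| * `|t| by rewrite -expr2 real_normK ?num_real.
set a := ('i * t%:C)%C; set A1 := heis H1 t A; set c := first_order_const h.
have c0 : 0 <= c by apply: first_order_const_ge0.
have e0 : onorm (heis H t A - A - a *: comm H A) <= c * t ^+ 2 * onorm A.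
  exact: heis_first.
have e1 : onorm (A1 - A - a *: comm H1 A) <= c * t ^+ 2 * onorm A.
  exact: heis_first.
have e2 : onorm (heis H2 t A1 - A1 - a *: comm H2 A1) <= c * t ^+ 2 * onorm A.
  apply: le_trans (heis_first A1 hH2 H2h t1) _.
  by rewrite ler_wpM2l ?onorm_heis // mulr_ge0 ?sqr_ge0.
have d : onorm (A1 - A) <= `|t| * (c + 2 * h) * onorm A.
  rewrite -[A1 - A](subrK (a *: comm H1 A)).
  apply: le_trans (onormD _ _) _.
  apply: le_trans (lerD e1 (onorm_it _ _)) _.
  have l1 : c * t ^+ 2 * onorm A <= `|t| * c * onorm A.
    by rewrite t2 ler_wpM2r // [_ * c]mulrC ler_wpM2l // ler_piMl.
  have l2 : `|t| * onorm (comm H1 A) <= `|t| * (2 * h) * onorm A.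
    rewrite -mulrA ler_wpM2l //; apply: le_trans (onorm_comm _ _) _.
    by rewrite ler_wpM2r // ler_wpM2l.
  apply: le_trans (lerD l1 l2) _; rewrite le_eqVlt; apply/orP; left; apply/eqP; ring.
have e3 : onorm (a *: comm H2 (A1 - A)) <= `|t| * (2 * h * (`|t| * (c + 2 * h) * onorm A)).
  apply: le_trans (onorm_it _ _) _; rewrite ler_wpM2l //.
  apply: le_trans (onorm_comm _ _) _; apply: ler_pM => //; last by rewrite ler_wpM2l.
    by rewrite mulr_ge0 ?onorm_ge0.
  exact: onorm_ge0.
have -> : heis H t A - heis H2 t A1 =
   (heis H t A - A - a *: comm H A) - (heis H2 t A1 - A1 - a *: comm H2 A1)
   - (A1 - A - a *: comm H1 A) - a *: comm H2 (A1 - A).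
  have -> : comm H A = comm H1 A + comm H2 A.
    by rewrite {1}HE 2!commDl H3A addr0.
  rewrite commBr.
  move: (heis H t A) (heis H2 t A1) (comm H1 A) (comm H2 A) (comm H2 A1) => p q x y z.
  by apply/matrixP => i j; rewrite !mxE; ring.
apply: le_trans (onormB _ _) _; apply: le_trans (lerD (onormB _ _) e3) _.
apply: le_trans (lerD (lerD (onormB _ _) e1) (lexx _)) _.
apply: le_trans (lerD (lerD (lerD e0 e2) (lexx _)) (lexx _)) _.
rewrite /second_order_const -/c t2 le_eqVlt; apply/orP; left; apply/eqP; ring.
Qed.

(** Move the conjugation from [a] to [B]: [V' B V = B + V' [B, V]], so the commutator with the
    conjugated operator differs from [[a, B]] only through [[V, B]]. *)
Lemma onorm_comm_conj (V V' a B : 'M[C]_n) : 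
  V *m V' = 1%:M -> V' *m V = 1%:M -> onorm V <= 1 -> onorm V' <= 1 ->
  onorm (comm (V *m a *m V') B) <= onorm (comm a B) + 2 * onorm a * onorm (comm V B).
Proof.
move=> VV' V'V V1 V'1.
have -> : comm (V *m a *m V') B = V *m comm a (B + V' *m comm B V) *m V'.
  have -> : B + V' *m comm B V = V' *m B *m V.
    by rewrite /comm mulmxBr !mulmxA V'V mul1mx addrC subrK.
  rewrite /comm mulmxBr mulmxBl !mulmxA VV' mul1mx; congr (_ - _).
  by rewrite -!mulmxA VV' mulmx1.
apply: le_trans (onorm_conj _ V1 V'1) _.
rewrite commDr; apply: le_trans (onormD _ _) _; rewrite lerD2l.
apply: le_trans (onorm_comm _ _) _; rewrite ler_wpM2l ?mulr_ge0 ?onorm_ge0 //.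
apply: le_trans (onormM _ _) _; rewrite (commN V B) onormN.
by rewrite ler_piMl ?onorm_ge0.
Qed.

(** The first summand is the splitting error inside a commutator; [8 h^2] is the Taylor remainder
    [2 h^2] of the unitary generated by [H2], doubled by a commutator and again by
    [onorm_comm_conj]. *)
Definition step_const h : R := 2 * second_order_const h + 8 * h ^+ 2.

(* [H1] collects the interactions inside the support of [A], [H2] those across its
   boundary and [H3] those outside.  Conjugation by the unitary generated by [H1] only
   replaces [A] by an observable of the same norm and support, so [H1] does not
   contribute to the growth of the commutator. *)
Lemma comm_heis_step H H1 H2 H3 s t A B h :
  H \is hermsymmx -> H1 \is hermsymmx -> H2 \is hermsymmx ->
  H = H1 + H2 + H3 -> comm H3 A = 0 ->
  onorm H <= h -> onorm H1 <= h -> onorm H2 <= h -> `|t| <= 1 ->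
  onorm (comm (heis H (s + t) A) B) <=
    onorm (comm (heis H s (heis H1 t A)) B) +
    2 * onorm A * (`|t| * onorm (comm (heis H s H2) B)) +
    step_const h * t ^+ 2 * onorm A * onorm B.
Proof.
move=> hH hH1 hH2 HE H3A Hh H1h H2h t1.
have h0 : 0 <= h := le_trans (onorm_ge0 H) Hh; have A0 := onorm_ge0 A.
have B0 := onorm_ge0 B.
have sp := heis_split hH hH1 hH2 HE H3A Hh H1h H2h t1.
set A1 := heis H1 t A in sp *.
have -> : heis H (s + t) A = heis H s (heis H2 t A1) + heis H s (heis H t A - heis H2 t A1).
  by rewrite -heisD addrCA subrr addr0 heis_add.
rewrite commDl; apply: le_trans (onormD _ _) _.
have l1 : onorm (comm (heis H s (heis H t A - heis H2 t A1)) B) <=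
    2 * (second_order_const h * t ^+ 2 * onorm A) * onorm B.
  apply: le_trans (onorm_comm _ _) _; rewrite ler_wpM2r // ler_wpM2l //.
  exact: le_trans (onorm_heis _ _ _) sp.
set V := heis H s (expU H2 t); set V' := heis H s (expU H2 (- t)).
have VV : heis H s (heis H2 t A1) = V *m heis H s A1 *m V'.
  by rewrite {1}/heis -!heisM.
have l2 : onorm (comm (heis H s (heis H2 t A1)) B) <=
    onorm (comm (heis H s A1) B) + 2 * onorm A * onorm (comm V B).
  rewrite VV; apply: le_trans (onorm_comm_conj _ _ _ _ _ _) _.
  - by rewrite -heisM expUVK heis1.
  - by rewrite -heisM expUK heis1.
  - exact: le_trans (onorm_heis _ _ _) (onorm_expU _ _).
  - exact: le_trans (onorm_heis _ _ _) (onorm_expU _ _).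
  rewrite lerD2l ler_wpM2r ?onorm_ge0 // ler_wpM2l //.
  by apply: le_trans (onorm_heis _ _ _) _; apply: onorm_heis.
have l3 : onorm (comm V B) <= `|t| * onorm (comm (heis H s H2) B) +
    2 * (2 * t ^+ 2 * h ^+ 2) * onorm B.
  pose r := expU H2 t - 1%:M - ('i * t%:C)%C *: H2.
  have -> : V = 1%:M + ('i * t%:C)%C *: heis H s H2 + heis H s r.
    have -> : r = expU H2 t - (1%:M + ('i * t%:C)%C *: H2) by rewrite /r opprD addrA.
    by rewrite -{1}(heis1 H s) -heisZ -!heisD addrCA subrr addr0.
  rewrite 2!commDl comm1l add0r commZl; apply: le_trans (onormD _ _) _.
  apply: lerD; first exact: onorm_it.
  apply: le_trans (onorm_comm _ _) _; rewrite ler_wpM2r // ler_wpM2l //.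
  apply: le_trans (onorm_heis _ _ _) _; apply: le_trans (expU_first t hH2) _.
  apply: ler_wpM2l; first by rewrite mulr_ge0 ?sqr_ge0.
  by rewrite ler_pXn2r ?nnegrE ?onorm_ge0.
apply: le_trans (lerD l2 l1) _.
have l4 : 2 * onorm A * onorm (comm V B) <= 2 * onorm A *
   (`|t| * onorm (comm (heis H s H2) B) + 2 * (2 * t ^+ 2 * h ^+ 2) * onorm B).
  by rewrite ler_wpM2l // mulr_ge0.
apply: le_trans (lerD (lerD (lexx _) l4) (lexx _)) _.
rewrite /step_const; move: (heis H s A1) (heis H s H2) => Y Z.
move: (onorm (comm Y B)) (onorm (comm Z B)) (onorm A) (onorm B).
by move=> p q a b; rewrite le_eqVlt; apply/orP; left; apply/eqP; ring.
Qed.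

End FirstOrder.

(** * Local operators *)

Section Locality.
Variables (R : realType) (D d : nat).
Local Notation C := R[i].
Local Notation normc := ComplexField.Normc.normc.
Local Notation crestr := Defs.crestr.
Implicit Types X Y Lam : {fset site D}.

Definition ent Lam (A : op R d Lam) (s t : conf d Lam) : C :=
  A (enum_rank s) (enum_rank t).

Definition mkop Lam (f : conf d Lam -> conf d Lam -> C) : op R d Lam :=
  \matrix_(i, j) f (enum_val i) (enum_val j).

Lemma ent_mkop Lam (f : conf d Lam -> conf d Lam -> C) s t : ent (mkop f) s t = f s t.
Proof. by rewrite /ent mxE !enum_rankK. Qed.

Lemma op_eqP Lam (A B : op R d Lam) : (forall s t, ent A s t = ent B s t) -> A = B.
Proof.
move=> AB; apply/matrixP => i j.
by have := AB (enum_val i) (enum_val j); rewrite /ent !enum_valK.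
Qed.

Lemma sum_enum_val (X : {fset site D}) (F : 'I_#|conf d X| -> C) :
  \sum_i F i = \sum_(s : conf d X) F (enum_rank s).
Proof. by rewrite (reindex enum_rank) //=; apply: onW_bij; exact: enum_rank_bij. Qed.

Lemma entM Lam (A B : op R d Lam) s t :
  ent (A *m B) s t = \sum_r ent A s r * ent B r t.
Proof. by rewrite /ent mxE sum_enum_val. Qed.

Lemma ent1 Lam (s t : conf d Lam) : ent (1%:M : op R d Lam) s t = (s == t)%:R.
Proof. by rewrite /ent mxE (can_eq enum_rankK). Qed.

Lemma ent_embed X Lam (XL : X `<=` Lam) (A : op R d X) s t :
  ent (embed XL A) s t =
    if agree_off X s t then ent A (crestr XL s) (crestr XL t) else 0.
Proof. by rewrite /ent mxE !enum_rankK. Qed.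

Definition upd Lam (s : conf d Lam) (x : Lam) (a : 'I_d) : conf d Lam :=
  [ffun y => if y == x then a else s y].

Definition mix Lam (Q : pred Lam) (r s : conf d Lam) : conf d Lam :=
  [ffun y => if Q y then r y else s y].

(* [A] acts as the identity on the site [x]. *)
Definition off Lam (x : Lam) (A : op R d Lam) : Prop :=
  (forall s t : conf d Lam, s x != t x -> ent A s t = 0) /\
  (forall (s t : conf d Lam) a, s x = t x -> ent A s t = ent A (upd s x a) (upd t x a)).

Definition supp Lam X (A : op R d Lam) : Prop :=
  forall z : Lam, val z \notin X -> off z A.

(** The sites of [Q] are overwritten one at a time along an enumeration. *)
Lemma off_mix Lam (A : op R d Lam) (Q : pred Lam) (r s t : conf d Lam) :
  (forall y, Q y -> off y A) -> (forall y, Q y -> s y = t y) ->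
  ent A s t = ent A (mix Q r s) (mix Q r t).
Proof.
move=> QA Qst.
have aux (l : seq Lam) : (forall y, y \in l -> Q y) ->
    ent A s t = ent A (mix (mem l) r s) (mix (mem l) r t).
  elim: l => [|y l IH] lQ.
    have m0 u : mix (mem [::]) r u = u by apply/ffunP => z; rewrite ffunE.
    by rewrite !m0.
  have mS u : mix (mem (y :: l)) r u = upd (mix (mem l) r u) y (r y).
    apply/ffunP => z; rewrite !ffunE /= in_cons.
    by case: eqVneq => [->|].
  rewrite !mS -(QA y (lQ y (mem_head _ _))).2.
    by apply: IH => z zl; apply: lQ; rewrite in_cons zl orbT.
  by rewrite !ffunE; case: ifP => // _; apply: Qst; apply: lQ; rewrite mem_head.
rewrite (aux (enum Q)) => [|y]; last by rewrite mem_enum.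
by congr (ent A _ _); apply/ffunP => z; rewrite !ffunE /= mem_enum.
Qed.

Lemma off_neq Lam (A : op R d Lam) x (s t : conf d Lam) : off x A -> s x != t x -> ent A s t = 0.
Proof. by move=> [+ _]; apply. Qed.

(* The only intermediate configuration that contributes agrees with [s] where [A]
   acts trivially and with [t] where [B] does. *)
Lemma mix_unique Lam (A B : op R d Lam) (Q : pred Lam) s t :
  (forall z, Q z -> off z A) -> (forall z, ~~ Q z -> off z B) ->
  ent (A *m B) s t = ent A s (mix Q s t) * ent B (mix Q s t) t.
Proof.
move=> QA QB; rewrite entM (bigD1 (mix Q s t)) //= big1 ?addr0 // => r rm.
have [z] : exists z, r z != mix Q s t z.
  apply: contrapT => /forallNP rz; move/eqP: rm; apply; apply/ffunP => z.
  by have /negP/negPn/eqP := rz z.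
rewrite ffunE; case: ifPn => Qz rz.
  by rewrite (off_neq (QA _ Qz)) ?mul0r // eq_sym.
by rewrite (off_neq (QB _ Qz) rz) mulr0.
Qed.

(** Each of the two products has a single contributing intermediate configuration, the one for
    [B *m A] being obtained by exchanging the roles of [s] and [t]. [off_mix] identifies the
    factors. *)
Lemma off_commute Lam (A B : op R d Lam) :
  (forall z, off z A \/ off z B) -> A *m B = B *m A.
Proof.
move=> AB; pose Q := [pred z : Lam | `[< off z A >]].
have QA z : Q z -> off z A by move=> /asboolP.
have QB z : ~~ Q z -> off z B by move=> /asboolPn nz; case: (AB z).
apply: op_eqP => s t; rewrite (mix_unique _ _ QA QB).
rewrite (@mix_unique _ B A (predC Q)); first last.
- by move=> z /negPn; apply: QA.
- by move=> z; apply: QB.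
have -> : ent A s (mix Q s t) = ent A (mix (predC Q) s t) t.
  rewrite (off_mix t QA) => [|y Qy]; last by rewrite ffunE Qy.
  by congr (ent A _ _); apply/ffunP => z; rewrite !ffunE /=; case: (`[< _ >]).
rewrite mulrC; congr (_ * _).
rewrite (@off_mix _ _ (predC Q) s) => [|y Qy|y Qy].
- by congr (ent B _ _); apply/ffunP => z; rewrite !ffunE /=; case: (`[< _ >]).
- exact: QB.
by rewrite ffunE ifN.
Qed.

Lemma supp_comm Lam X Y (A B : op R d Lam) :
  supp X A -> supp Y B -> [disjoint X & Y]%fset -> comm A B = 0.
Proof.
move=> sA sB XY; rewrite /comm (@off_commute _ A B) ?subrr // => z.
have [zX|zX] := boolP (val z \in X); last by left; apply: sA.
right; apply: sB; apply/negP => zY; move/fdisjointP: XY => /(_ _ zX).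
by rewrite zY.
Qed.

Lemma embed_supp X Lam (XL : X `<=` Lam) (A : op R d X) : supp X (embed XL A).
Proof.
move=> z zX; split=> [s t st|s t a st].
  rewrite ent_embed ifN //; apply/negP => /forallP /(_ z).
  by rewrite zX (negPf st).
rewrite !ent_embed.
have -> : agree_off X (upd s z a) (upd t z a) = agree_off X s t.
  apply: eq_forallb => y; rewrite !ffunE; have [->|/negPf yz] := eqVneq y z.
    by rewrite st !eqxx.
  by rewrite ?yz.
have cr u : crestr XL (upd u z a) = crestr XL u.
  apply/ffunP => y; rewrite !ffunE ifN //.
  by apply: contra zX => /eqP <-; exact: (fsvalP y).
by rewrite !cr.
Qed.

Definition extend Lam X (b : conf d Lam) (p : conf d X) : conf d Lam :=
  [ffun y => if insub (val y) is Some y' then p y' else b y].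

Lemma extend_crestr X Lam (XL : X `<=` Lam) b s :
  extend b (crestr XL s) = mix [pred y | val y \notin X] b s.
Proof.
apply/ffunP => y; rewrite !ffunE /=; case: insubP => [y' yX ev|/negPf -> //].
by rewrite yX /= ffunE; congr (s _); apply: val_inj.
Qed.

Lemma crestr_extend X Lam (XL : X `<=` Lam) b p : crestr XL (extend b p) = p.
Proof.
apply/ffunP => y; rewrite !ffunE /=.
by case: insubP => [y' _ /val_inj->//|]; rewrite fsvalP.
Qed.

Lemma agree_off_extend X Lam (b : conf d Lam) (p : conf d X) : agree_off X (extend b p) b.
Proof.
apply/forallP => y; apply/implyP => yX; rewrite ffunE insubN //.
Qed.

Lemma agree_offP Lam X (s t : conf d Lam) :
  reflect (forall z : Lam, val z \notin X -> s z = t z) (agree_off X s t).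
Proof.
apply: (iffP forallP) => [h z zX|h z]; first by have /implyP/(_ zX)/eqP := h z.
by apply/implyP => zX; rewrite h.
Qed.

Lemma extend_crestrK X Lam (XL : X `<=` Lam) (b s : conf d Lam) :
  agree_off X s b -> extend b (crestr XL s) = s.
Proof.
move=> /agree_offP sb; rewrite extend_crestr; apply/ffunP => z; rewrite ffunE /=.
by case: ifP => // zX; rewrite sb.
Qed.

(** The block of [A] in which the sites outside [X] are frozen to [b]. It inverts [embed] on
    operators supported in [X], and as a compression it does not increase the norm. *)
Definition red X Lam (b : conf d Lam) (A : op R d Lam) : op R d X :=
  mkop (fun p q => ent A (extend b p) (extend b q)).

Lemma supp_embedK X Lam (XL : X `<=` Lam) b (A : op R d Lam) :
  supp X A -> embed XL (red X b A) = A.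
Proof.
move=> sA; apply: op_eqP => s t; rewrite ent_embed; case: ifPn => [/agree_offP st|].
  by rewrite ent_mkop !extend_crestr; apply/esym/off_mix; [exact: sA|exact: st].
rewrite /agree_off negb_forall => /existsP[z]; rewrite negb_imply => /andP[zX st].
by rewrite (off_neq (sA _ zX)).
Qed.

Lemma hermP n (A : 'M[C]_n) : reflect (A ^t* = A) (A \is hermsymmx).
Proof.
rewrite is_hermitianmxE expr0 scale1r eq_sym; exact: eqP.
Qed.

Lemma red_herm X Lam b (A : op R d Lam) : A \is hermsymmx -> red X b A \is hermsymmx.
Proof.
move=> /hermP hA; apply/hermP; apply: op_eqP => p q.
by rewrite /ent !mxE !enum_rankK /ent -[in RHS]hA !mxE.
Qed.

Lemma embed_herm X Lam (XL : X `<=` Lam) (A : op R d X) :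
  A \is hermsymmx -> embed XL A \is hermsymmx.
Proof.
move=> /hermP hA; apply/hermP; apply: op_eqP => p q.
rewrite /ent !mxE /= !enum_rankK.
have -> : agree_off X q p = agree_off X p q.
  by apply: eq_forallb => z; rewrite eq_sym.
by case: ifP => _; rewrite ?rmorph0 // -[in RHS]hA !mxE.
Qed.

Lemma embedN X Lam (XL : X `<=` Lam) (A : op R d X) : embed XL (- A) = - embed XL A.
Proof. by apply/matrixP => i j; rewrite !mxE /=; case: (agree_off _ _ _); rewrite ?mxE ?oppr0. Qed.

Definition vent X (u : 'cV[C]_#|conf d X|) (s : conf d X) : C := u (enum_rank s) 0.

Lemma nsq_vent X (u : 'cV[C]_#|conf d X|) : nsq u = \sum_s normc (vent u s) ^+ 2.
Proof. by rewrite /nsq (reindex enum_rank) //=; apply: onW_bij; exact: enum_rank_bij. Qed.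

Lemma vent_mul Lam (A : op R d Lam) u s : vent (A *m u) s = \sum_t ent A s t * vent u t.
Proof. by rewrite /vent mxE sum_enum_val. Qed.

Lemma sum_extend (V : nmodType) X Lam (XL : X `<=` Lam) (b : conf d Lam) (F : conf d Lam -> V) :
  \sum_(t | agree_off X t b) F t = \sum_(q : conf d X) F (extend b q).
Proof.
rewrite (reindex_onto (extend b) (crestr XL)) /=; last exact: extend_crestrK.
by apply: eq_bigl => q; rewrite agree_off_extend crestr_extend eqxx.
Qed.

(** Placing a vector on the configurations that agree with [b] off [X], with zeros elsewhere, is an
    isometry; [red] is [A] between such vectors, with the other output coordinates dropped. *)
Lemma onorm_red X Lam (XL : X `<=` Lam) b (A : op R d Lam) : onorm (red X b A) <= onorm A.
Proof.
apply: onorm_le => [|u]; first exact: onorm_ge0.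
pose u' : 'cV[C]_#|conf d Lam| := \col_i
  if agree_off X (enum_val i) b then vent u (crestr XL (enum_val i)) else 0.
have u'E s : vent u' s = if agree_off X s b then vent u (crestr XL s) else 0.
  by rewrite /vent mxE enum_rankK.
have -> : l2norm u = l2norm u'.
  rewrite !l2normE !nsq_vent; congr Num.sqrt.
  rewrite [RHS](bigID (fun s => agree_off X s b)) /= [X in _ + X]big1 ?addr0.
    rewrite (sum_extend XL); apply: eq_bigr => q _.
    by rewrite u'E agree_off_extend crestr_extend.
  by move=> s sb; rewrite u'E ifN // ComplexField.Normc.normc0 expr0n.
apply: le_trans (l2norm_mul_le A u'); rewrite !l2normE ler_sqrt ?nsq_ge0 // !nsq_vent.
rewrite [leRHS](bigID (fun s => agree_off X s b)) /= (sum_extend XL).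
rewrite -[leLHS]addr0 lerD ?sumr_ge0 // => [|s _]; last by rewrite sqr_ge0.
rewrite le_eqVlt; apply/orP; left; apply/eqP; apply: eq_bigr => p _.
congr (normc _ ^+ 2); rewrite !vent_mul.
rewrite [RHS](bigID (fun s => agree_off X s b)) /= [X in _ + X]big1 ?addr0.
  rewrite (sum_extend XL); apply: eq_bigr => q _.
  by rewrite u'E agree_off_extend crestr_extend ent_mkop.
by move=> s sb; rewrite u'E ifN // mulr0.
Qed.

(** The embedded operator is block diagonal over the classes of configurations that agree off [X],
    each block being a copy of [A]. The configuration [b] picks a representative [rep] of each
    class. *)
Lemma onorm_embed X Lam (XL : X `<=` Lam) (A : op R d X) (b : conf d Lam) :
  onorm (embed XL A) <= onorm A.
Proof.
apply: onorm_le => [|u]; first exact: onorm_ge0.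
rewrite l2norm_le ?onorm_ge0 // !nsq_vent.
pose rep := mix [pred y : Lam | val y \in X] b.
have repK s : rep (rep s) = rep s.
  by apply/ffunP => z; rewrite !ffunE /=; case: (val z \in X).
have rep_agree s r : rep r = r -> (rep s == r) = agree_off X s r.
  move=> rr; apply/eqP/agree_offP => [<- z zX|sr].
    by rewrite ffunE /= (negPf zX).
  by rewrite -rr; apply/ffunP => z; rewrite !ffunE /=; case: ifPn => // /sr.
have split (F : conf d Lam -> R) : \sum_s F s =
    \sum_(r | rep r == r) \sum_(q : conf d X) F (extend r q).
  rewrite (partition_big rep (fun r => rep r == r)) => [|s _]; last by rewrite repK.
  apply: eq_bigr => r /eqP rr; rewrite -(sum_extend XL).
  by apply: eq_bigl => s /=; rewrite rep_agree.
rewrite !split mulr_sumr; apply: ler_sum => r _.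
pose v : 'cV[C]_#|conf d X| := \col_i vent u (extend r (enum_val i)).
have vE q : vent v q = vent u (extend r q) by rewrite /vent mxE enum_rankK.
have -> : \sum_(q : conf d X) normc (vent (embed XL A *m u) (extend r q)) ^+ 2 = nsq (A *m v).
  rewrite nsq_vent; apply: eq_bigr => p _; congr (normc _ ^+ 2); rewrite !vent_mul.
  rewrite (bigID (fun s => agree_off X s r)) /= [X in _ + X]big1 ?addr0.
    rewrite (sum_extend XL); apply: eq_bigr => q _.
    rewrite vE ent_embed !crestr_extend ifT //; apply/agree_offP => z zX.
    by rewrite !ffunE !insubN.
  move=> s sr; rewrite ent_embed ifN ?mul0r //; apply: contra sr => /agree_offP h.
  by apply/agree_offP => z zX; rewrite -h // ffunE insubN.
under eq_bigr do rewrite -vE.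
by rewrite -nsq_vent -l2norm_le ?onorm_ge0 // l2norm_mul_le.
Qed.

End Locality.

(** * Local decomposition of an operator *)

Section SignedShifts.
Variables (R : realType) (D d : nat) (Lam : {fset site D}).
Local Notation C := R[i].
Local Notation Op := (op R d.+1 Lam).
Local Notation Conf := (conf d.+1 Lam).
Implicit Types (x y z : Lam) (A B : Op) (s t : Conf).

(* Signed cyclic shifts of the basis of C^(d+1): averaging the conjugations by the
   corresponding unitaries at one site gives the normalized partial trace there. *)
Definition signed_shift : finType := ('I_d.+1 * {ffun 'I_d.+1 -> bool})%type.
Implicit Types g h : signed_shift.

Definition wop x g : Op :=
  mkop (fun s t => if s == upd t x (t x + g.1) then (-1) ^+ g.2 (t x) else 0 : C).

Definition wconj x g A : Op := wop x g *m A *m (wop x g)^t*.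

Lemma upd_upd s x a b : upd (upd s x a) x b = upd s x b.
Proof. by apply/ffunP => y; rewrite !ffunE; case: (y == x). Qed.

Lemma upd_id s x : upd s x (s x) = s.
Proof. by apply/ffunP => y; rewrite !ffunE; case: eqVneq => [->|]. Qed.

Lemma upd_eqx s x a : upd s x a x = a.
Proof. by rewrite ffunE eqxx. Qed.

Lemma upd_neq s x y a : y != x -> upd s x a y = s y.
Proof. by rewrite ffunE => /negPf->. Qed.

Lemma shift_eq x a s t : (s == upd t x (t x + a)) = (t == upd s x (s x - a)).
Proof.
apply/eqP/eqP => ->; apply/ffunP => y; rewrite !ffunE eqxx; case: eqVneq => // ->.
  by rewrite addrK.
by rewrite subrK.
Qed.

Lemma ent_adj A s t : ent (A ^t*) s t = (ent A t s)^*.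
Proof. by rewrite /ent !mxE. Qed.

Lemma conj_sign (b : bool) : ((-1) ^+ b)^* = (-1) ^+ b :> C.
Proof. by rewrite rmorphXn rmorphN1. Qed.

Lemma ent_wopl x g A s t : ent (wop x g *m A) s t =
  (-1) ^+ g.2 (s x - g.1) * ent A (upd s x (s x - g.1)) t.
Proof.
rewrite entM (bigD1 (upd s x (s x - g.1))) //= big1 ?addr0 => [|r rs].
  by rewrite ent_mkop shift_eq eqxx upd_eqx.
by rewrite ent_mkop shift_eq (negPf rs) mul0r.
Qed.

Lemma ent_wopr x g A s t : ent (A *m (wop x g)^t*) s t =
  (-1) ^+ g.2 (t x - g.1) * ent A s (upd t x (t x - g.1)).
Proof.
rewrite entM (bigD1 (upd t x (t x - g.1))) //= big1 ?addr0 => [|r rs].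
  by rewrite ent_adj ent_mkop shift_eq eqxx upd_eqx conj_sign mulrC.
by rewrite ent_adj ent_mkop shift_eq (negPf rs) rmorph0 mulr0.
Qed.

Lemma ent_wconj x g A s t : ent (wconj x g A) s t =
  (-1) ^+ g.2 (s x - g.1) * (-1) ^+ g.2 (t x - g.1) *
    ent A (upd s x (s x - g.1)) (upd t x (t x - g.1)).
Proof. by rewrite /wconj ent_wopr ent_wopl mulrCA mulrA. Qed.

Lemma wopK x g : wop x g *m (wop x g)^t* = 1%:M.
Proof.
apply: op_eqP => s t; have := ent_wconj x g 1%:M s t.
rewrite /wconj mulmx1 => ->; rewrite !ent1.
have [->|st] := eqVneq s t; first by rewrite eqxx mulr1 -expr2 sqrr_sign.
rewrite (_ : _ == _ = false) ?mulr0 //; apply: contra_neqF st => /eqP st.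
have : (s x - g.1) = (t x - g.1) by rewrite -(upd_eqx s x (s x - g.1)) st upd_eqx.
move=> /addIr sx; rewrite -(upd_id s x) -(upd_id t x) sx.
by rewrite -(upd_upd s x (s x - g.1)) st upd_upd.
Qed.

Lemma wopKV x g : (wop x g)^t* *m wop x g = 1%:M.
Proof. exact: mulmx1C (wopK x g). Qed.

Lemma onorm_wop x g : onorm (wop x g) <= 1.
Proof. exact: onorm_unitary (wopKV x g). Qed.

Lemma onorm_wop_adj x g : onorm ((wop x g)^t*) <= 1.
Proof. by apply: onorm_unitary; rewrite trmxCK wopK. Qed.

Lemma off_wop x y g : y != x -> off y (wop x g).
Proof.
move=> yx; split=> [s t st|s t a st]; rewrite !ent_mkop.
  rewrite ifN //; apply: contra st => /eqP ->.
  by rewrite upd_neq.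
have -> : (upd s y a == upd (upd t y a) x (upd t y a x + g.1)) =
          (s == upd t x (t x + g.1)).
  have xy : x != y by rewrite eq_sym.
  rewrite (upd_neq _ _ xy).
  apply/eqP/eqP => [/ffunP e|->]; apply/ffunP => z.
    have := e z; rewrite !ffunE; case: (eqVneq z x) => [->|zx].
      by rewrite (negPf xy).
    by case: (eqVneq z y) => [->|].
  rewrite !ffunE; case: (eqVneq z x) => [->|zx]; first by rewrite (negPf xy).
  by [].
by rewrite upd_neq // eq_sym.
Qed.

Lemma wop_supp x g : supp [fset val x] (wop x g).
Proof.
move=> z; rewrite in_fset1 => zx; apply: off_wop.
by apply: contra zx => /eqP ->.
Qed.

Lemma off_comm_wop x g A : off x A -> A *m wop x g = wop x g *m A.
Proof.
move=> xA; apply: off_commute => z; have [->|zx] := eqVneq z x; first by left.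
by right; apply: off_wop.
Qed.

Lemma comm_wop_adj x g A : A *m wop x g = wop x g *m A ->
  A *m (wop x g)^t* = (wop x g)^t* *m A.
Proof.
move=> AW; rewrite -[LHS]mul1mx -(wopKV x g) -!mulmxA; congr (_ *m _).
by rewrite !mulmxA -AW -mulmxA wopK mulmx1.
Qed.

Lemma wconj_id x g A : off x A -> wconj x g A = A.
Proof. by move=> xA; rewrite /wconj -(off_comm_wop g xA) -mulmxA wopK mulmx1. Qed.

End SignedShifts.

(** * The normalized partial trace at one site as an average over unitaries *)

HB.lock Definition site_avg (R : realType) (D d : nat) (Lam : {fset site D}) (x : Lam)
    (A : op R d.+1 Lam) : op R d.+1 Lam :=
  #|signed_shift d|%:R^-1 *: \sum_g wconj x g A.

Section SiteAverage.
Variables (R : realType) (D d : nat) (Lam : {fset site D}).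
Local Notation C := R[i].
Local Notation Op := (op R d.+1 Lam).
Local Notation Conf := (conf d.+1 Lam).
Implicit Types (x y z : Lam) (A B : Op) (s t : Conf).

Local Notation signed_shift := (signed_shift d).
Local Notation wop := (@wop R D d Lam).
Implicit Types g h : signed_shift.

Lemma site_avgE x A : site_avg x A = #|signed_shift|%:R^-1 *: \sum_g wconj x g A.
Proof. by rewrite site_avg.unlock. Qed.

Lemma card_shift_neq0 : #|signed_shift|%:R != 0 :> C.
Proof.
by rewrite pnatr_eq0 -lt0n; apply/card_gt0P; exists (0, [ffun=> false]).
Qed.

Lemma avg_const A : #|signed_shift|%:R^-1 *: (\sum_(g : signed_shift) A) = A :> Op.
Proof.
by rewrite sumr_const -scalerMnr scalerMnl -mulr_natr mulVf ?scale1r ?card_shift_neq0.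
Qed.

Lemma site_avg_id x A : off x A -> site_avg x A = A.
Proof.
move=> xA; rewrite !site_avgE (eq_bigr (fun=> A)) => [|g _]; last exact: wconj_id.
exact: avg_const.
Qed.

(** Averaging over the signs removes the entries that are off-diagonal at [x]; averaging over the
    shifts turns the diagonal ones into a trace. *)
Lemma ent_site_avg x A s t : ent (site_avg x A) s t =
  if s x == t x then d.+1%:R^-1 * \sum_a ent A (upd s x a) (upd t x a) else 0.
Proof.
rewrite {1}/ent site_avgE mxE summxE.
under eq_bigr do rewrite -/(ent _ _ _) ent_wconj.
rewrite -(pair_bigA _ (fun (a : 'I_d.+1) (e : {ffun 'I_d.+1 -> bool}) =>
  (-1) ^+ e (s x - a) * (-1) ^+ e (t x - a) *
  ent A (upd s x (s x - a)) (upd t x (t x - a)))) /=.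
under eq_bigr do rewrite -mulr_suml.
case: eqVneq => st.
  rewrite st.
  under eq_bigr => a _.
    under eq_bigr do rewrite -expr2 sqrr_sign.
    rewrite sumr_const; over.
  rewrite -mulr_sumr mulrA; congr (_ * _).
    rewrite card_prod natrM invfM -mulrA mulVf ?mulr1 ?card_ord //.
    by rewrite pnatr_eq0 -lt0n; apply/card_gt0P; exists [ffun=> false].
  rewrite [RHS](reindex (fun a => t x - a)) //=.
  by exists (fun a => t x - a) => a _; rewrite opprB addrC subrK.
rewrite big1 ?mulr0 // => a _; apply/eqP; rewrite mulf_eq0; apply/orP; left.
(* Flipping the sign at the single index [s x - a] negates exactly one of the two factors, since
   [s x != t x]; hence the sum over signs equals its own opposite. *)
pose flip (e : {ffun 'I_d.+1 -> bool}) : {ffun 'I_d.+1 -> bool} :=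
  [ffun j => (j == s x - a) (+) e j].
have flipK : involutive flip.
  by move=> e; apply/ffunP => j; rewrite !ffunE addbA addbb.
set S := \sum_e _; have SN : S = - S.
  rewrite {1}/S (reindex_inj (inv_inj flipK)) /= -sumrN; apply: eq_bigr => e _.
  rewrite !ffunE eqxx (inj_eq (addIr _)) (eq_sym (t x)) (negPf st) addFb.
  by rewrite addTb signrN mulNr.
by rewrite -[_ == 0](mulrn_eq0 S 2) mulr2n {1}SN addNr.
Qed.

Lemma off_site_avg x A : off x (site_avg x A).
Proof.
split=> [s t st|s t a st]; rewrite !ent_site_avg; first by rewrite (negPf st).
rewrite st !upd_eqx !eqxx; congr (_ * _); apply: eq_bigr => b _.
by rewrite !upd_upd.
Qed.

(** Such an [A] is its own average. With [off_comm_wop], this describes [off x] as a commutant,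
    whence its closure under sums, products and exponentials. *)
Lemma off_commP x A : (forall g, A *m wop x g = wop x g *m A) -> off x A.
Proof.
move=> xA; suff <- : site_avg x A = A by apply: off_site_avg.
rewrite !site_avgE (eq_bigr (fun=> A)) => [|g _].
  exact: avg_const.
by rewrite /wconj -xA -mulmxA wopK mulmx1.
Qed.

Lemma off0 x : off x (0 : Op).
Proof. by apply: off_commP => g; rewrite mul0mx mulmx0. Qed.

Lemma offD x A B : off x A -> off x B -> off x (A + B).
Proof.
move=> xA xB; apply: off_commP => g.
by rewrite mulmxDl mulmxDr !(off_comm_wop g).
Qed.

Lemma offM x A B : off x A -> off x B -> off x (A *m B).
Proof.
move=> xA xB; apply: off_commP => g.
by rewrite -mulmxA (off_comm_wop g xB) !mulmxA (off_comm_wop g xA).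
Qed.

Lemma off_adj_wop x y g : y != x -> off y ((wop x g)^t*).
Proof.
move=> yx; apply: off_commP => h; apply/esym/comm_wop_adj/esym.
exact: off_comm_wop (off_wop _ g yx).
Qed.

Lemma off_sum x (I : finType) (P : pred I) (F : I -> Op) :
  (forall i, P i -> off x (F i)) -> off x (\sum_(i | P i) F i).
Proof. by move=> xF; elim/big_ind: _ => //; [exact: off0|move=> *; exact: offD]. Qed.

Lemma off_expU x A (t : R) : A \is hermsymmx -> off x A -> off x (expU A t : Op).
Proof.
move=> hA xA; apply: off_commP => g; apply: expU_comm => //.
exact: off_comm_wop.
Qed.

Lemma off_heis x A B (t : R) : A \is hermsymmx -> off x A -> off x B -> off x (heis A t B : Op).
Proof.
by move=> hA xA xB; apply: offM; first apply: offM; rewrite ?off_expU //; apply: off_expU.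
Qed.

Lemma site_avgB x A B : site_avg x (A - B) = site_avg x A - site_avg x B.
Proof.
rewrite !site_avgE -scalerBr -sumrB; congr (_ *: _); apply: eq_bigr => g _.
by rewrite /wconj mulmxBr mulmxBl.
Qed.

Lemma site_avg_sum x (I : finType) (P : pred I) (F : I -> Op) :
  site_avg x (\sum_(i | P i) F i) = \sum_(i | P i) site_avg x (F i).
Proof.
rewrite site_avgE; under [RHS]eq_bigr do rewrite site_avgE.
rewrite -scaler_sumr exchange_big /=; congr (_ *: _).
by apply: eq_bigr => g _; rewrite /wconj mulmx_sumr mulmx_suml.
Qed.

Lemma site_avgC x y A : site_avg x (site_avg y A) = site_avg y (site_avg x A).
Proof.
have [->//|xy] := eqVneq x y.
rewrite !site_avgE.
have aux z (F : signed_shift -> Op) c : \sum_g wconj z g (c *: \sum_h F h) =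
    c *: \sum_g \sum_h wconj z g (F h).
  rewrite [RHS]scaler_sumr; apply: eq_bigr => g _.
  by rewrite /wconj -scalemxAr -scalemxAl mulmx_sumr mulmx_suml.
rewrite !aux [in RHS]exchange_big /=; congr (_ *: _); congr (_ *: _).
apply: eq_bigr => g _; apply: eq_bigr => h _.
have WV : wop x g *m wop y h = wop y h *m wop x g.
  by apply: off_comm_wop; apply: off_wop; rewrite eq_sym.
have WV' : (wop x g)^t* *m (wop y h)^t* = (wop y h)^t* *m (wop x g)^t*.
  by rewrite -!map_mxM -!trmx_mul WV.
by rewrite /wconj !mulmxA WV -!mulmxA WV'.
Qed.

Lemma site_avg_adj x A : (site_avg x A)^t* = site_avg x (A^t*).
Proof.
rewrite !site_avgE linearZ /= map_mxZ raddf_sum /= raddf_sum /=; congr (_ *: _).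
  by rewrite fmorphV rmorph_nat.
apply: eq_bigr => g _; rewrite /wconj !trmx_mul !map_mxM mulmxA.
by rewrite trmxCK.
Qed.

Lemma onorm_avg (F : signed_shift -> Op) c : (forall g, onorm (F g) <= c) ->
  onorm (#|signed_shift|%:R^-1 *: \sum_g F g) <= c.
Proof.
move=> Fc; apply: le_trans (onormZ_le _ _) _.
have -> : ComplexField.Normc.normc (#|signed_shift|%:R^-1 : C) = #|signed_shift|%:R^-1.
  apply: complexI; rewrite -normC_normc ger0_norm ?invr_ge0 ?ler0n //.
  by rewrite fmorphV rmorph_nat.
rewrite mulrC ler_pdivrMr; last first.
  by rewrite ltr0n; apply/card_gt0P; exists (0, [ffun=> false]).
apply: le_trans (onorm_sum _ _ _) _; apply: le_trans (ler_sum _ (fun g _ => Fc g)) _.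
by rewrite sumr_const mulr_natr.
Qed.

Lemma onorm_site_avg x A : onorm (site_avg x A) <= onorm A.
Proof.
rewrite site_avgE; apply: onorm_avg => g.
by apply: onorm_conj; [exact: onorm_wop|exact: onorm_wop_adj].
Qed.

Lemma sub_site_avg x A :
  A - site_avg x A = #|signed_shift|%:R^-1 *: \sum_g comm A (wop x g) *m (wop x g)^t*.
Proof.
rewrite site_avgE -{1}[A]avg_const -scalerBr -sumrB; congr (_ *: _); apply: eq_bigr => g _.
by rewrite /comm mulmxBl /wconj -[A *m _ *m _]mulmxA wopK mulmx1.
Qed.

(** Apply [sub_site_avg] at [x] and at [y]. The adjoint unitary left over at [x] commutes with the
    unitaries at [y], so it factors out and a double commutator of [A] remains. *)
Lemma onorm_sub_site_avg2 x y A c : x != y ->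
  (forall g h, onorm (comm (comm A (wop x g)) (wop y h)) <= c) ->
  onorm ((A - site_avg x A) - site_avg y (A - site_avg x A)) <= c.
Proof.
move=> xy Ac; rewrite (sub_site_avg y); apply: onorm_avg => h.
apply: le_trans (onormM _ _) _.
rewrite -[c]mulr1; apply: ler_pM; rewrite ?onorm_ge0 ?onorm_wop_adj //.
rewrite sub_site_avg commZl comm_suml; apply: onorm_avg => g.
have WV : (wop x g)^t* *m wop y h = wop y h *m (wop x g)^t*.
  by apply: off_comm_wop; apply: off_adj_wop; rewrite eq_sym.
have -> : comm (comm A (wop x g) *m (wop x g)^t*) (wop y h) =
    comm (comm A (wop x g)) (wop y h) *m (wop x g)^t*.
  by rewrite {1}/comm -mulmxA WV !mulmxA -mulmxBl.
apply: le_trans (onormM _ _) _.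
by rewrite -[c]mulr1; apply: ler_pM; rewrite ?onorm_ge0 ?onorm_wop_adj.
Qed.

End SiteAverage.

(** * Components of an operator indexed by regions *)

Section Components.
Variables (R : realType) (D d : nat) (Lam : {fset site D}).
Local Notation C := R[i].
Local Notation Op := (op R d.+1 Lam).
Implicit Types (x y z : Lam) (A B H : Op) (Q : pred Lam) (l : seq Lam).

Definition comp Q z A : Op := if Q z then A - site_avg z A else site_avg z A.

Definition proj l Q A : Op := foldr (comp Q) A l.

Lemma compC Q y z A : comp Q y (comp Q z A) = comp Q z (comp Q y A).
Proof.
have E := site_avgC y z A; rewrite /comp; case: (Q y); case: (Q z).
- rewrite !site_avgB E !opprB; move: (site_avg z A) (site_avg y A) => p q.
  by rewrite addrACA [RHS]addrACA [- p - q]addrC.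
- by rewrite site_avgB E.
- by rewrite site_avgB E.
- exact: E.
Qed.

Lemma proj_compC l Q z A : comp Q z (proj l Q A) = proj l Q (comp Q z A).
Proof. by elim: l => //= y l IH; rewrite compC IH. Qed.

Lemma proj_rem l Q z A : z \in l -> proj l Q A = proj (rem z l) Q (comp Q z A).
Proof.
elim: l => //= y l IH; rewrite in_cons; have [->|zy] := eqVneq z y => /=.
  by rewrite proj_compC.
by move=> zl; rewrite (IH zl).
Qed.

Lemma comp0 Q z : comp Q z 0 = 0.
Proof. by rewrite /comp site_avg_id ?subrr ?if_same //; exact: off0. Qed.

Lemma proj0 l Q : proj l Q 0 = 0.
Proof. by elim: l => //= z l ->; exact: comp0. Qed.

Lemma comp_sum Q z (I : finType) (F : I -> Op) :
  comp Q z (\sum_i F i) = \sum_i comp Q z (F i).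
Proof.
by rewrite /comp; case: (Q z); rewrite site_avg_sum ?sumrB.
Qed.

Lemma proj_sum l Q (I : finType) (F : I -> Op) :
  proj l Q (\sum_i F i) = \sum_i proj l Q (F i).
Proof. by elim: l => //= z l ->; exact: comp_sum. Qed.

Lemma proj_eq0 l Q z A : z \in l -> Q z -> off z A -> proj l Q A = 0.
Proof.
by move=> zl Qz zA; rewrite (proj_rem _ _ zl) /comp Qz site_avg_id // subrr proj0.
Qed.

Lemma proj_off l Q z A : z \in l -> ~~ Q z -> off z (proj l Q A).
Proof.
move=> zl Qz; rewrite (proj_rem _ _ zl) -proj_compC /comp (negPf Qz).
exact: off_site_avg.
Qed.

Lemma eq_proj l Q1 Q2 A : (forall z, z \in l -> Q1 z = Q2 z) -> proj l Q1 A = proj l Q2 A.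
Proof.
elim: l => //= z l IH Q12; rewrite /comp Q12 ?mem_head // IH // => y yl.
by rewrite Q12 // in_cons yl orbT.
Qed.

Lemma proj_herm l Q A : A \is hermsymmx -> proj l Q A \is hermsymmx.
Proof.
move=> hA; elim: l => //= z l /hermP IH; apply/hermP.
by rewrite /comp; case: (Q z); rewrite ?linearB ?map_mxB /= site_avg_adj IH.
Qed.

Lemma onorm_proj l Q A : onorm (proj l Q A) <= 2 ^+ count Q l * onorm A.
Proof.
elim: l => /= [|z l IH]; first by rewrite expr0 mul1r.
rewrite /comp; case: (Q z) => /=; last first.
  by rewrite add0n (le_trans (onorm_site_avg _ _)).
rewrite add1n exprS -mulrA mulr_natl mulr2n.
apply: le_trans (onormB _ _) _; apply: lerD => //.
exact: le_trans (onorm_site_avg _ _) IH.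
Qed.

(** Expansion of the product over [l] of [(1 - E_z) + E_z = 1]. In the inductive step the sets [Q]
    and [x |: Q] are paired, and their components add up to the component for the shorter list. *)
Lemma sum_proj l A : uniq l ->
  \sum_(Q : {set Lam} | Q \subset [set z in l]) proj l (mem Q) A = A.
Proof.
elim: l => [_|x l IH /= /andP[xl ul]].
  rewrite (big_pred1 finset.set0) //= => Q; rewrite /= -finset.subset0.
  have -> // : [set z in [::]] = finset.set0 :> {set Lam}.
  by apply/finset.setP => z; rewrite !inE.
rewrite (bigID (fun Q : {set Lam} => x \in Q)) /=.
rewrite (reindex_onto (fun Q : {set Lam} => x |: Q)%SET
                      (fun Q : {set Lam} => Q :\ x)%SET) /=; last first.
  by move=> Q /andP[_ xQ]; rewrite finset.setD1K.
have e1 (Q : {set Lam}) : (((x |: Q)%SET \subset [set z in x :: l]) &&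
    (x \in (x |: Q)%SET) && (((x |: Q) :\ x)%SET == Q)) = (Q \subset [set z in l]).
  apply/idP/idP => [/andP[/andP[/fintype.subsetP s _] /eqP e]|/fintype.subsetP s].
    apply/fintype.subsetP => z zQ; have zx : z != x.
      by apply: contraTneq zQ => ->; rewrite -e !inE eqxx.
    by have := s z; rewrite !inE zQ orbT (negPf zx) => /(_ isT).
  have xQ : x \notin Q by apply: contra xl => /s; rewrite inE.
  rewrite finset.setU1K // eqxx !inE eqxx !andbT; apply/fintype.subsetP => z.
  by rewrite !inE => /orP[->//|/s]; rewrite inE => ->; rewrite orbT.
have e2 (Q : {set Lam}) : ((Q \subset [set z in x :: l]) && (x \notin Q)) =
    (Q \subset [set z in l]).
  apply/idP/idP => [/andP[/fintype.subsetP s xQ]|/fintype.subsetP s].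
    apply/fintype.subsetP => z zQ; have zx : z != x.
      by apply: contraTneq zQ => ->.
    by have := s z zQ; rewrite !inE (negPf zx).
  have xQ : x \notin Q by apply: contra xl => /s; rewrite inE.
  rewrite xQ andbT; apply/fintype.subsetP => z /s; rewrite !inE => ->.
  by rewrite orbT.
rewrite (eq_bigl _ _ e1) (eq_bigl _ _ e2) -big_split /= -[RHS](IH ul).
apply: eq_bigr => Q /fintype.subsetP s.
have xQ : x \notin Q by apply: contra xl => /s; rewrite inE.
rewrite /comp /= !inE eqxx /= (negPf xQ).
rewrite (@eq_proj l (mem (x |: Q)%SET) (mem Q)) ?subrK // => z zl.
rewrite /= !inE; case: eqVneq => // zx; move: xl; by rewrite -zx zl.
Qed.

Definition in_region (X : {fset site D}) : pred Lam := [pred z | val z \in X].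

Lemma sum_proj_fpowerset A :
  \sum_(X : fpowerset Lam) proj (enum {: Lam}) (in_region (val X)) A = A.
Proof.
rewrite -[RHS](sum_proj A (enum_uniq Lam)).
rewrite [RHS](eq_bigl xpredT); last first.
  by move=> Q; apply/fintype.subsetP => z _; rewrite inE mem_enum.
pose f (X : fpowerset Lam) : {set Lam} := [set z | in_region (val X) z].
have finj : injective f.
  move=> X Y /finset.setP XY; apply/val_inj/fsetP => z.
  have [zL|zL] := boolP (z \in Lam).
    by have := XY [` zL]; rewrite !inE.
  by apply/idP/idP => zX; have /fsubsetP s := fpowerset_sub X;
    have /fsubsetP s' := fpowerset_sub Y; [move: (s _ zX)|move: (s' _ zX)];
    rewrite (negPf zL).
(* Surjectivity follows by counting: both sides have [2 ^ #|Lam|] elements. *)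
have fbij : bijective f.
  apply: inj_card_bij => //.
  have -> : #|{: {set Lam}}| = (2 ^ #|{: Lam}|)%N.
    by rewrite -cardsT -finset.powersetT card_powerset cardsT.
  by rewrite -!cardfE card_fpowerset.
rewrite (reindex f) /=; last exact: onW_bij.
by apply: eq_bigr => X _; apply: eq_proj => z _; rewrite /= inE.
Qed.

Lemma count_in_region X : (count (in_region X) (enum {: Lam}) <= #|` X|)%N.
Proof.
rewrite -size_filter -(size_map val); apply: uniq_leq_size => [|z].
  by rewrite (map_inj_uniq val_inj) filter_uniq // enum_uniq.
by move=> /mapP[y]; rewrite mem_filter => /andP[yX _] ->.
Qed.

(** The one-site maps commute, so those at [x] and [y] may act first. Of the others only those at
    sites of [X] cost a factor 2. *)
Lemma onorm_proj_pair X x y A c : val x \in X -> val y \in X -> x != y -> 0 <= c ->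
  (forall g h, onorm (comm (comm A (wop R x g)) (wop R y h)) <= c) ->
  onorm (proj (enum {: Lam}) (in_region X) A) <= 2 ^+ #|` X| * c.
Proof.
move=> xX yX xy c0 Ac.
have yl : y \in rem x (enum {: Lam}).
  by rewrite mem_rem_uniq ?enum_uniq // inE eq_sym xy mem_enum.
rewrite (@proj_rem _ _ x) ?mem_enum // (proj_rem _ _ yl).
apply: le_trans (onorm_proj _ _ _) _; apply: ler_pM.
- by rewrite exprn_ge0.
- exact: onorm_ge0.
- rewrite ler_eXn2l ?ltr1n //; apply: leq_trans (count_in_region X).
  by rewrite !(count_rem) !mem_enum /=; lia.
rewrite /comp /in_region /= xX yX.
exact: onorm_sub_site_avg2.
Qed.

End Components.

(** * From bounds at small times to a double commutator *)

Section DoubleCommutator.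
Variables (R : realType) (n : nat).
Local Notation C := R[i].
Implicit Types (H A B : 'M[C]_n) (c s t : R).

Lemma opnormE A : opnorm A = onorm A.
Proof. by rewrite onorm.unlock. Qed.

Lemma onormZ (c : C) A : onorm (c *: A) = ComplexField.Normc.normc c * onorm A.
Proof.
apply/le_anti; rewrite onormZ_le /=; have [->|c0] := eqVneq c 0.
  by rewrite ComplexField.Normc.normc0 mul0r onorm_ge0.
have n0 : 0 < ComplexField.Normc.normc c.
  rewrite lt_def normc_ge0 andbT; apply: contra c0 => /eqP.
  by move/ComplexField.Normc.eq0_normc => ->.
rewrite -{1}[A]scale1r -(mulVf c0) -scalerA mulrC -ler_pdivlMr //.
by rewrite mulrC -ComplexField.Normc.normcV onormZ_le.
Qed.

(** From [exp(- x) >= 1 - x] one gets [exp(x) <= 1 / (1 - x)]. *)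
Lemma expRB1_le (x : R) : 0 <= x -> x <= 1 / 2 -> expR x - 1 <= x + 2 * x ^+ 2.
Proof.
move=> x0 x1; have := expR_ge1Dx (- x); rewrite expRN => h.
have p := expR_gt0 x.
have {h}h : expR x * (1 - x) <= 1 by rewrite mulrC -ler_pdivlMr // div1r.
rewrite lerBlDr -(@ler_pM2r _ (1 - x)); last by lra.
apply: le_trans h _; rewrite -subr_ge0.
rewrite (_ : _ - _ = x ^+ 2 * (1 - 2 * x)); last by ring.
by rewrite mulr_ge0 ?sqr_ge0 //; lra.
Qed.

(** Stands in for a limit at 0+: here for differentiating at time 0, later for letting the slack
    [dl] vanish. *)
Lemma ler_linear_limit (y b m u : R) : 0 <= m -> 0 < u ->
  (forall t, 0 < t -> t <= u -> y <= b + m * t) -> y <= b.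
Proof.
move=> m0 u0 h; apply/ler_addgt0Pr => e e0.
pose t := Num.min u (e / (m + 1)).
have t0 : 0 < t by rewrite lt_min u0 divr_gt0 // ltr_wpDl.
have tu : t <= u by rewrite ge_min lexx.
apply: le_trans (h t t0 tu) _; rewrite lerD2l.
apply: (@le_trans _ _ ((m + 1) * t)); first by rewrite ler_wpM2r ?lerDl // ltW.
rewrite -ler_pdivlMl ?ltr_wpDl // mulrC.
by rewrite ge_min lexx orbT.
Qed.

(** As [[A, B] = 0], the first-order term of [[tau_t(A), B]] is [i t [[H, A], B]]. Divide by [t] and
    let it tend to 0. *)
Lemma double_comm_bound H A B c s : H \is hermsymmx -> comm A B = 0 ->
  onorm A <= 1 -> onorm B <= 1 -> 0 <= c -> 0 < s ->
  (forall t, 0 < t -> onorm (comm (heis H t A) B) <= c * (expR (s * t) - 1)) ->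
  onorm (comm (comm H A) B) <= c * s.
Proof.
move=> hH AB A1 B1 c0 s0 hb.
pose M := first_order_const (onorm H).
have M0 : 0 <= M by apply: first_order_const_ge0; exact: onorm_ge0.
(* Below [u], both [heis_first] (time at most 1) and [expRB1_le] ([s * t] at most 1/2) apply. *)
pose u : R := Num.min 1 (1 / (2 * s)).
have u0 : 0 < u by rewrite lt_min ltr01 divr_gt0 // mulr_gt0.
apply: (@ler_linear_limit _ _ (2 * c * s ^+ 2 + 2 * M) u) => //.
  by rewrite addr_ge0 ?mulr_ge0 ?exprn_ge0 // ltW.
move=> t t0; rewrite le_min => /andP[t1 ts].
have st : s * t <= 1 / 2.
  by rewrite -ler_pdivlMl // div1r -invfM mulrC -div1r.
have tn : `|t| = t by rewrite ger0_norm // ltW.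
have hf := heis_first A hH (lexx _) (_ : `|t| <= 1); rewrite tn in hf.
have {}hf := hf t1.
set r := heis H t A - A - _ in hf.
have E : ('i * t%:C)%C *: comm (comm H A) B = comm (heis H t A) B - comm r B.
  have HE : heis H t A = A + ('i * t%:C)%C *: comm H A + r.
    by rewrite /r -[_ - A - _]addrA -opprD addrCA subrr addr0.
  by rewrite HE 2!commDl AB add0r addrK commZl.
rewrite -(ler_pM2l t0) -{1}tn -normc_it -onormZ E.
apply: le_trans (onormB _ _) _.
have rB : onorm (comm r B) <= 2 * (M * t ^+ 2).
  apply: le_trans (onorm_comm _ _) _.
  apply: (@le_trans _ _ (2 * onorm r)); first by rewrite ler_piMr // mulr_ge0 ?onorm_ge0.
  rewrite ler_wpM2l //; apply: le_trans hf _.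
  by rewrite ler_piMr // mulr_ge0 ?sqr_ge0.
have eB : c * (expR (s * t) - 1) <= c * (s * t + 2 * (s * t) ^+ 2).
  by rewrite ler_wpM2l // expRB1_le // mulr_ge0 ?ltW.
apply: le_trans (lerD (le_trans (hb t t0) eB) rB) _.
by rewrite le_eqVlt; apply/orP; left; apply/eqP; ring.
Qed.

End DoubleCommutator.

Section LocalDecomposition.
Variables (R : realType) (D d : nat).
Local Notation C := R[i].
Implicit Types (X Y Lam : {fset site D}).

Lemma sum_herm n (I : finType) (P : pred I) (F : I -> 'M[C]_n) :
  (forall i, P i -> F i \is hermsymmx) -> \sum_(i | P i) F i \is hermsymmx.
Proof.
move=> hF; elim/big_ind: _ => [|A B /hermP hA /hermP hB|i Pi]; last exact: hF.
  by apply/hermP; rewrite trmx0 map_mx0.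
by apply/hermP; rewrite linearD map_mxD /= hA hB.
Qed.

Lemma hamiltonian_herm Lam (Psi : potential_on R d Lam) : hamiltonian Psi \is hermsymmx.
Proof. by apply: sum_herm => X _; apply: embed_herm; exact: pot_on_herm. Qed.

Lemma tauE Lam (Phi : potential R D d) t (A : op R d Lam) :
  tau Phi t A = heis (hamiltonian (Defs.restrict Phi Lam)) t A.
Proof. exact: evolE (hamiltonian_herm _). Qed.

Lemma comm_boundP Lam (Phi : potential R D d) X Y (XL : X `<=` Lam) (YL : Y `<=` Lam) t c :
  comm_bound Phi XL YL t c <->
  forall (A : op R d X) (B : op R d Y),
    onorm (comm (heis (hamiltonian (Defs.restrict Phi Lam)) t (embed XL A)) (embed YL B)) <=
      c * (onorm A * onorm B).
Proof.
have embed0 Z (ZL : Z `<=` Lam) : embed ZL (0 : op R d Z) = 0.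
  apply/matrixP => i j; rewrite !mxE /=.
  by case: (agree_off _ _ _); rewrite ?mxE.
split=> [h A B|h A B A0 B0]; last first.
  have := h A B; rewrite !opnormE tauE ler_pdivrMr //.
  by rewrite mulr_gt0 ?onorm_gt0.
have [->|A0] := eqVneq A 0.
  by rewrite embed0 onorm0 mul0r mulr0 /heis mulmx0 mul0mx /comm mul0mx mulmx0 subrr onorm0.
have [->|B0] := eqVneq B 0.
  by rewrite embed0 onorm0 !mulr0 /comm mul0mx mulmx0 subrr onorm0.
have := h A B A0 B0; rewrite !opnormE tauE ler_pdivrMr //.
by rewrite mulr_gt0 ?onorm_gt0.
Qed.

(** A pair realizing the diameter may coincide only if the diameter is 0, and then any second site
    of [X] serves. Distinctness is what the single-site bound requires. *)
Lemma diam_pair X : (2 <= #|` X|)%N ->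
  exists x y, [/\ x \in X, y \in X, x != y & (diam X <= gdist x y)%N].
Proof.
move=> X2; have X0 : (0 < #|{: X}|)%N by rewrite -cardfE; lia.
have [x Dx] := bigop.eq_bigmax (fun x : X => \max_(y : X) gdist (val x) (val y)) X0.
have [y Dy] := bigop.eq_bigmax (fun y : X => gdist (val x) (val y)) X0.
have Dxy : diam X = gdist (val x) (val y) by rewrite /diam Dx Dy.
have [xy|xy] := eqVneq (val x) (val y); last first.
  by exists (val x), (val y); split; rewrite ?fsvalP ?Dxy.
have D0 : diam X = 0%N.
  by rewrite Dxy xy gdistE big1 // => i _; rewrite subrr.
have [z zX zx] : exists2 z, z \in X & z != val x.
  have : (0 < #|` X `\ val x|)%N.
    by move: X2; rewrite (cardfsD1 (val x)) fsvalP; lia.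
  rewrite cardfs_gt0 => /fset0Pn[z]; rewrite in_fsetD1 => /andP[zx zX].
  by exists z.
by exists z, (val x); split; rewrite ?fsvalP ?D0.
Qed.

End LocalDecomposition.

(** * The decaying potential that generates the same evolution *)

Section LocalPotential.
Variables (R : realType) (D d : nat) (Phi : potential R D d.+1) (Lam : {fset site D}).
Local Notation H := (hamiltonian (Defs.restrict Phi Lam)).

Definition base_conf : conf d.+1 Lam := [ffun=> ord0].

Definition local_term (X : {fset site D}) : op R d.+1 Lam :=
  proj (enum {: Lam}) (in_region X) H.

Fact local_potential_herm (X : fpowerset Lam) :
  red (val X) base_conf (local_term (val X)) \is hermsymmx.
Proof. by apply: red_herm; apply: proj_herm; exact: hamiltonian_herm. Qed.

Definition local_potential : potential_on R d.+1 Lam := PotentialOn local_potential_herm.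

Lemma embed_local_potential (X : fpowerset Lam) :
  embed (fpowerset_sub X) (local_potential X) = local_term (val X).
Proof.
apply: supp_embedK => z zX; apply: proj_off; rewrite ?mem_enum //.
Qed.

Lemma hamiltonian_local_potential : hamiltonian local_potential = H.
Proof.
rewrite -[RHS]sum_proj_fpowerset; apply: eq_bigr => X _.
exact: embed_local_potential.
Qed.

(** An interaction on [Z] with at most [k] sites misses some site [x] of a larger [X], and [1 - E_x]
    annihilates it. *)
Lemma kbody_local_potential k : kbody k Phi -> kbody_on k local_potential.
Proof.
move=> kP X kX; rewrite /= /local_term proj_sum big1.
  by apply: op_eqP => p q; rewrite ent_mkop /ent !mxE.
move=> Z _ /=.
have [kZ|Zk] := ltnP k #|` val Z|.
  rewrite kP // (_ : embed _ 0 = 0) ?proj0 //.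
  apply/matrixP => i j; rewrite !mxE /=.
  by case: (agree_off _ _ _); rewrite ?mxE.
have [x xX xZ] : exists2 x, x \in val X & x \notin val Z.
  have : ~~ (val X `<=` val Z).
    by apply/negP => /fsubset_leq_card; lia.
  by move=> /fsubsetPn[x xX xZ]; exists x.
have xL : x \in Lam by have /fsubsetP s := fpowerset_sub X; apply: s.
apply: (@proj_eq0 _ _ _ _ _ _ [` xL]); rewrite ?mem_enum //.
by apply: embed_supp.
Qed.

Lemma onorm_local_potential k (mu v K : R) (X : fpowerset Lam) :
  kbody k Phi -> 0 < mu -> 0 < v -> 0 < K -> single_site_LR_bounds Phi mu v K ->
  (2 <= #|` val X|)%N ->
  onorm (local_potential X) <=
    2 ^+ k * (mu * v * K) * expR (- (mu * (diam (val X))%:R)).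
Proof.
move=> kP mu0 v0 K0 LR X2.
have rhs0 : 0 <= 2 ^+ k * (mu * v * K) * expR (- (mu * (diam (val X))%:R)).
  by rewrite !mulr_ge0 ?exprn_ge0 ?expR_ge0 ?ltW.
have [kX|Xk] := ltnP k #|` val X|.
  by rewrite (kbody_local_potential kP kX) onorm0.
apply: le_trans (onorm_red (fpowerset_sub X) _ _) _.
have [x [y [xX yX xy dxy]]] := diam_pair X2.
have /fsubsetP XL := fpowerset_sub X.
have xL := XL _ xX; have yL := XL _ yX.
have c0 : 0 <= mu * v * K * expR (- (mu * (diam (val X))%:R)).
  by rewrite !mulr_ge0 ?expR_ge0 ?ltW.
apply: le_trans (@onorm_proj_pair _ _ _ _ _ [` xL] [` yL] _ _ xX yX xy c0 _) _; last first.
  by rewrite -[leRHS]mulrA ler_wpM2r // ler_eXn2l ?ltr1n.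
move=> g h.
have x1 : [fset x] `<=` Lam by rewrite fsub1set.
have y1 : [fset y] `<=` Lam by rewrite fsub1set.
(* The averaging unitaries are embedded one-site observables, so the single-site hypothesis applies
   to them. *)
have W1 : embed x1 (red [fset x] base_conf (wop R [` xL] g)) = wop R [` xL] g.
  by apply: supp_embedK; exact: (@wop_supp R D d Lam [` xL] g).
have W2 : embed y1 (red [fset y] base_conf (wop R [` yL] h)) = wop R [` yL] h.
  by apply: supp_embedK; exact: (@wop_supp R D d Lam [` yL] h).
rewrite (_ : mu * v * K * _ = (K * expR (- (mu * (diam (val X))%:R))) * (mu * v)); last ring.
apply: double_comm_bound.
- exact: hamiltonian_herm.
- apply: (supp_comm (@wop_supp R D d Lam [` xL] g) (@wop_supp R D d Lam [` yL] h)).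
  by rewrite fdisjoint1X in_fset1.
- exact: onorm_wop.
- exact: onorm_wop.
- by rewrite mulr_ge0 ?expR_ge0 ?ltW.
- by rewrite mulr_gt0.
move=> t t0; have /comm_boundP := LR Lam x y x1 y1 t xy.
move=> /(_ (red [fset x] base_conf (wop R [` xL] g)) (red [fset y] base_conf (wop R [` yL] h))).
rewrite W1 W2 => /le_trans; apply.
have e0 : 0 <= expR (mu * v * t) - 1.
  by rewrite subr_ge0 -expR0 ler_expR !mulr_ge0 ?ltW.
rewrite (ger0_norm (ltW t0)).
apply: (@le_trans _ _ (K * (expR (mu * v * t) - 1) * expR (- (mu * (gdist x y)%:R)) * 1)).
  rewrite ler_wpM2l ?mulr_ge0 ?expR_ge0 ?(ltW K0) //.
  rewrite -[1]mulr1; apply: ler_pM; rewrite ?onorm_ge0 //.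
    exact: le_trans (onorm_red x1 _ _) (onorm_wop _ _ _).
  exact: le_trans (onorm_red y1 _ _) (onorm_wop _ _ _).
rewrite mulr1 mulrAC ler_wpM2r // ler_wpM2l ?(ltW K0) // ler_expR lerN2.
by rewrite ler_wpM2l ?(ltW mu0) // ler_nat.
Qed.

End LocalPotential.

(** * Lattice sums *)

Section LatticeSums.
Variable R : realType.

Lemma sum_inj_le (I J : finType) (P : pred I) (h : I -> J) (F : J -> R) :
  {in P &, injective h} -> (forall j, 0 <= F j) ->
  \sum_(i | P i) F (h i) <= \sum_j F j.
Proof.
move=> hinj F0; rewrite -(big_imset F (A := P) (h := h)) //=.
rewrite [leRHS](bigID (fun j => j \in [set h i | i in P])) /=.
by rewrite lerDl sumr_ge0.
Qed.

Lemma sum_geometric_le (q : R) (N : nat) : 0 <= q -> q < 1 ->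
  \sum_(i < N) q ^+ i <= (1 - q)^-1.
Proof.
move=> q0 q1; have p : 0 < 1 - q by rewrite subr_gt0.
rewrite -[leRHS]div1r ler_pdivlMr //.
have -> : (\sum_(i < N) q ^+ i) * (1 - q) = 1 - q ^+ N.
  elim: N => [|N IH]; first by rewrite big_ord0 mul0r expr0 subrr.
  by rewrite big_ord_recr /= mulrDl IH exprS; ring.
by rewrite gerBl exprn_ge0.
Qed.

Lemma absz_sign_inj (a b c : int) :
  `|a - b|%N = `|a - c|%N -> (a <= b) = (a <= c) -> b = c.
Proof.
case: (lerP a b) => ab; case: (lerP a c) => ac // + _.
  move=> /(congr1 Posz); rewrite !abszE !ler0_norm ?subr_le0 // => /oppr_inj.
  by move=> /addrI/oppr_inj.
move=> /(congr1 Posz); rewrite !abszE !gtr0_norm ?subr_gt0 //.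
by move=> /addrI/oppr_inj.
Qed.

(** A site is determined by the distance and the side of each of its coordinates relative to [x].
    The sum is thus at most a product of [D] geometric series, the two sides giving the factor 2. *)
Lemma sum_gdist_le (D : nat) (q : R) (Lam : {fset site D}) (x : site D) :
  0 <= q -> q < 1 ->
  \sum_(z : Lam) q ^+ gdist x (val z) <= (2 / (1 - q)) ^+ D.
Proof.
move=> q0 q1; pose N := (\max_(z : Lam) gdist x (val z)).+1.
have cN (z : Lam) i : (`|x i - val z i| < N)%N.
  rewrite ltnS (leq_trans _ (leq_bigmax z)) // gdistE (bigD1 i) //=.
  exact: leq_addr.
pose h (z : Lam) : {ffun 'I_D -> 'I_N * bool} :=
  [ffun i => (Ordinal (cN z i), x i <= val z i)].
have hinj : {in xpredT &, injective h}.
  move=> z z' _ _ /ffunP hz; apply/val_inj/ffunP => i.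
  have := hz i; rewrite !ffunE => -[]; rewrite -!/(val _).
  exact: absz_sign_inj.
pose F (f : {ffun 'I_D -> 'I_N * bool}) : R := \prod_i q ^+ (f i).1.
apply: (@le_trans _ _ (\sum_f F f)).
  apply: le_trans (sum_inj_le hinj _); last first.
    by move=> f; apply: prodr_ge0 => i _; rewrite exprn_ge0.
  apply: ler_sum => z _; rewrite gdistE -prodrXr /F le_eqVlt; apply/orP; left.
  by apply/eqP/eq_bigr => i _; rewrite ffunE.
rewrite /F -(bigA_distr_bigA (fun _ (p : 'I_N * bool) => q ^+ p.1)).
rewrite prodr_const card_ord; apply: lerXn2r; rewrite ?nnegrE.
- by apply: sumr_ge0 => p _; rewrite exprn_ge0.
- by rewrite divr_ge0 // subr_ge0 ltW.
rewrite -(pair_bigA _ (fun (i : 'I_N) (_ : bool) => q ^+ i)) /=.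
under eq_bigr do rewrite sumr_const card_bool -mulr_natl.
rewrite -mulr_sumr ler_wpM2l //.
exact: sum_geometric_le.
Qed.

Lemma gdist_le_diam (D : nat) (Z : {fset site D}) x y :
  x \in Z -> y \in Z -> (gdist x y <= diam Z)%N.
Proof.
move=> xZ yZ; apply: leq_trans (bigop.leq_bigmax [` xZ]).
exact: (bigop.leq_bigmax (F := fun y : Z => gdist x (val y)) [` yZ]).
Qed.

(* A region with at most [k] sites is the image of a [k]-tuple, and its diameter
   dominates the mean distance of the tuple to [x], so the sum factorizes. *)
Lemma sum_regions_le (D k : nat) (b : R) (Lam : {fset site D}) (x : Lam) : 0 < b ->
  \sum_(Z : fpowerset Lam | (val x \in val Z) && (#|` val Z| <= k)%N)
     expR (- (b * (k * diam (val Z))%:R)) <=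
  ((2 / (1 - expR (- b))) ^+ D) ^+ k.
Proof.
move=> b0; set q := expR (- b).
have q0 : 0 <= q by apply: expR_ge0.
have q1 : q < 1 by rewrite /q expR_lt1 oppr_lt0.
have qE n : expR (- (b * n%:R)) = q ^+ n by rewrite -mulNr mulrC expRM_natl.
pose l (Z : fpowerset Lam) := [seq z <- enum {: Lam} | in_region (val Z) z].
(* Padding with [x] itself, a site of [Z], keeps the range of the tuple equal to [Z], whence
   injectivity. *)
pose h (Z : fpowerset Lam) : {ffun 'I_k -> Lam} := [ffun i : 'I_k => nth x (l Z) i].
pose F (f : {ffun 'I_k -> Lam}) : R := \prod_i q ^+ gdist (val x) (val (f i)).
have hZ (Z : fpowerset Lam) i : val x \in val Z -> val (h Z i) \in val Z.
  move=> xZ; rewrite ffunE; have [il|il] := ltnP i (size (l Z)).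
    by have := mem_nth x il; rewrite mem_filter => /andP[].
  by rewrite nth_default.
have hinj : {in (fun Z : fpowerset Lam => (val x \in val Z) && (#|` val Z| <= k)%N) &,
    injective h}.
  have sub (Z Z' : fpowerset Lam) : (#|` val Z| <= k)%N -> val x \in val Z' ->
      h Z = h Z' -> {subset val Z <= val Z'}.
    move=> Zk xZ' hh z zZ.
    have zL : z \in Lam by have /fsubsetP s := fpowerset_sub Z; apply: s.
    have zl : [` zL] \in l Z by rewrite mem_filter mem_enum andbT; exact: zZ.
    have il : (index [` zL] (l Z) < k)%N.
      apply: leq_trans Zk; apply: leq_trans (count_in_region Lam _).
      by rewrite -size_filter index_mem.
    have := hZ Z' (Ordinal il) xZ'; rewrite -hh ffunE /= nth_index //.
  move=> Z Z' /andP[xZ Zk] /andP[xZ' Zk'] hh; apply/val_inj/fsetP => z.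
  by apply/idP/idP; [apply: (sub Z Z')|apply: (sub Z' Z)].
apply: (@le_trans _ _ (\sum_f F f)).
  apply: le_trans (sum_inj_le hinj _); last first.
    by move=> f; apply: prodr_ge0 => i _; rewrite exprn_ge0.
  apply: ler_sum => Z /andP[xZ Zk]; rewrite qE /F prodrXr.
  apply: ler_wiXn2l => //; first exact: ltW.
  apply: (@leq_trans (\sum_(i < k) diam (val Z))).
    by apply: leq_sum => i _; apply: gdist_le_diam => //; apply: hZ.
  by rewrite sum_nat_const card_ord.
rewrite /F -(bigA_distr_bigA (fun _ z => q ^+ gdist (val x) (val z))).
rewrite prodr_const card_ord; apply: lerXn2r; rewrite ?nnegrE.
- by apply: sumr_ge0 => p _; rewrite exprn_ge0.
- by rewrite exprn_ge0 // divr_ge0 // subr_ge0 ltW.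
- exact: sum_gdist_le.
Qed.

End LatticeSums.

(** * Lieb-Robinson bound *)

Lemma not_fdisjoint (K : choiceType) (X Y : {fset K}) :
  ~~ [disjoint X & Y]%fset -> exists2 x, x \in X & x \in Y.
Proof.
by rewrite -fsetI_eq0 => /fset0Pn[x]; rewrite in_fsetI => /andP[xX xY]; exists x.
Qed.

Lemma card_in_region (D : nat) (Lam X : {fset site D}) :
  (#|in_region (Lam := Lam) X| <= #|` X|)%N.
Proof.
rewrite cardE -(size_map val); apply: uniq_leq_size => [|z].
  by rewrite (map_inj_uniq val_inj) enum_uniq.
by move=> /mapP[y]; rewrite mem_enum => yX ->.
Qed.

Lemma step_const_ge0 (R : realType) (r : R) : 0 <= r -> 0 <= step_const r.
Proof.
move=> r0; have := first_order_const_ge0 r0; rewrite /step_const /second_order_const.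
move: (first_order_const r) => c c0.
by rewrite !(addr_ge0, mulr_ge0, exprn_ge0, ler0n).
Qed.

Section LiebRobinson.
Variables (R : realType) (D d : nat) (Lam Y : {fset site D}).
Local Notation Op := (op R d.+1 Lam).
Variables (h : fpowerset Lam -> Op) (B : Op) (dY : site D -> R) (mu s : R).
Hypothesis h_herm : forall Z, h Z \is hermsymmx.
Hypothesis h_supp : forall Z, supp (val Z) (h Z).
Hypothesis B_supp : supp Y B.
Hypothesis dY_lip : forall x z, dY x <= dY z + (gdist x z)%:R.
Hypothesis dY_le0 : forall y, y \in Y -> dY y <= 0.
Hypothesis mu0 : 0 <= mu.
Hypothesis s0 : 0 <= s.
Hypothesis h_sum : forall x : Lam,
  \sum_(Z : fpowerset Lam | (val x \in val Z) && (2 <= #|` val Z|)%N)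
    onorm (h Z) * (#|` val Z|%:R * expR (mu * (diam (val Z))%:R)) <= s.
Implicit Types (X : {fset site D}) (A : Op) (t e : R).

Local Notation H := (\sum_Z h Z).

Definition weight X : R := \sum_(x : Lam | val x \in X) expR (- (mu * dY (val x))).

Definition meets X : R := if [disjoint X & Y]%fset then 0 else 1.

Definition boundary X (Z : fpowerset Lam) : bool :=
  ~~ (val Z `<=` X) && ~~ [disjoint val Z & X]%fset.

Lemma weight_ge0 X : 0 <= weight X.
Proof. by apply: sumr_ge0 => x _; exact: expR_ge0. Qed.

Lemma meets_ge0 X : 0 <= meets X.
Proof. by rewrite /meets; case: ifP. Qed.

(** A common site of [Z] and [Y] alone contributes at least 1 to the weight, [dY] being nonpositive
    there. *)
Lemma meets_le_weight (Z : fpowerset Lam) : meets (val Z) <= weight (val Z).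
Proof.
rewrite /meets; case: ifPn => [_|]; first exact: weight_ge0.
move=> /not_fdisjoint[x xZ xY].
have /fsubsetP ZL := fpowerset_sub Z; pose x' : Lam := [` ZL _ xZ].
rewrite /weight (bigD1 x') //= -[leLHS]addr0 lerD ?sumr_ge0 //.
by rewrite -expR0 ler_expR oppr_ge0 mulr_ge0_le0 // dY_le0.
Qed.

(** The Lipschitz property moves every site of [Z] to [x] at the cost of [exp(mu diam Z)]; this is
    the origin of the factor in [h_sum]. *)
Lemma weight_le (Z : fpowerset Lam) x : x \in val Z ->
  weight (val Z) <= #|` val Z|%:R * expR (mu * (diam (val Z))%:R) * expR (- (mu * dY x)).
Proof.
move=> xZ.
apply: (@le_trans _ _ (\sum_(z in in_region (Lam := Lam) (val Z))
    expR (mu * (diam (val Z))%:R) * expR (- (mu * dY x)))).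
  apply: ler_sum => z zZ; rewrite -expRD ler_expR -!mulrN -mulrDr ler_wpM2l //.
  have dd : (gdist x (val z))%:R <= (diam (val Z))%:R :> R.
    by rewrite ler_nat gdist_le_diam.
  have := dY_lip x (val z); lra.
rewrite sumr_const -[leRHS]mulrA -[leLHS]mulr_natl ler_wpM2r ?mulr_ge0 ?expR_ge0 //.
by rewrite ler_nat card_in_region.
Qed.

(** A boundary region meets [X], so it may be charged to all sites of the intersection. Exchanging
    the sums leaves [h_sum] at each site of [X]. *)
Lemma boundary_sum X :
  \sum_(Z | boundary X Z) onorm (h Z) * weight (val Z) <= s * weight X.
Proof.
pose c (Z : fpowerset Lam) := onorm (h Z) * (#|` val Z|%:R * expR (mu * (diam (val Z))%:R)).
have c0 Z : 0 <= c Z by rewrite mulr_ge0 ?onorm_ge0 // mulr_ge0 ?expR_ge0.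
apply: (@le_trans _ _ (\sum_(Z | boundary X Z) \sum_(x : Lam | (val x \in X) && (val x \in val Z))
    expR (- (mu * dY (val x))) * c Z)).
  apply: ler_sum => Z /andP[_ /not_fdisjoint[x xZ xX]].
  have /fsubsetP ZL := fpowerset_sub Z; pose x' : Lam := [` ZL _ xZ].
  rewrite (bigD1 x') /=; last by rewrite xX.
  rewrite -[leLHS]addr0 lerD ?sumr_ge0 //; last first.
    by move=> z _; rewrite mulr_ge0 ?expR_ge0.
  rewrite /c mulrCA ler_wpM2l ?onorm_ge0 // [leRHS]mulrC.
  exact: weight_le.
rewrite (exchange_big_dep (fun x : Lam => val x \in X)) /=; last by move=> Z x _ /andP[].
rewrite /weight mulr_sumr; apply: ler_sum => x xX.
rewrite -mulr_sumr mulrC ler_wpM2r ?expR_ge0 //; apply: le_trans (h_sum x).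
rewrite [leRHS]big_mkcond [leLHS]big_mkcond /=; apply: ler_sum => Z _.
rewrite xX /= /boundary; have [xZ|xZ] := boolP (val x \in val Z); rewrite ?andbF //=.
rewrite andbT; case: ifPn => [/andP[ZX _]|_]; last first.
  by case: ifP => // _; exact: c0.
(* A region with one site that meets [X] lies inside [X], so a boundary region has at least two
   sites. *)
rewrite ifT // ltnNge; apply: contra ZX => Z1.
apply/fsubsetP => z zZ; suff -> : z = val x by [].
apply: contraTeq Z1 => zx; rewrite -ltnNge.
have : (#|` [fset z; val x]| <= #|` val Z|)%N.
  by apply: fsubset_leq_card; apply/fsubsetP => y /fset2P[]->.
by rewrite cardfs2 zx.
Qed.

Local Notation hn := (\sum_Z onorm (h Z)).

Lemma hn_ge0 : 0 <= hn.
Proof. by apply: sumr_ge0 => Z _; exact: onorm_ge0. Qed.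

Lemma onorm_partial (P : pred (fpowerset Lam)) : onorm (\sum_(Z | P Z) h Z) <= hn.
Proof.
apply: le_trans (onorm_sum _ _ _) _; rewrite [leRHS](bigID P) /= lerDl.
by apply: sumr_ge0 => Z _; exact: onorm_ge0.
Qed.

(* The slack [dl * expR ((2 * hn + 1) * t)] absorbs the quadratic error of one time step. *)
Definition envelope X t dl : R :=
  2 * onorm B * (weight X * (expR (2 * s * t) - 1) + meets X) +
  dl * expR ((2 * hn + 1) * t).

(** The slacks of the four hypotheses add up exactly to that of the conclusion. This dictates the
    exponents: [2 r] balances the weights, [2 n] the slack carried by the boundary regions, and the
    extra 1 the error [T]. *)
Lemma envelope_arith (b w m E E' G G' n r e dl S T : R) :
  2 * e * S <= 2 * e * (2 * b * E * (r * w) + n * (dl * G)) ->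
  2 * b * (w * (E * (1 + 2 * r * e))) <= 2 * b * (w * E') ->
  dl * (G * (1 + (2 * n + 1) * e)) <= dl * G' -> T <= dl * G * e ->
  2 * b * (w * (E - 1) + m) + dl * G + 2 * e * S + T <= 2 * b * (w * (E' - 1) + m) + dl * G'.
Proof.
move=> l1 l2 l3 l4; rewrite -subr_ge0.
have : 0 <= (2 * e * (2 * b * E * (r * w) + n * (dl * G)) - 2 * e * S) +
   (2 * b * (w * E') - 2 * b * (w * (E * (1 + 2 * r * e)))) +
   (dl * G' - dl * (G * (1 + (2 * n + 1) * e))) + (dl * G * e - T).
  by apply: addr_ge0; [apply: addr_ge0; [apply: addr_ge0|]|]; rewrite subr_ge0.
by move=> /le_trans; apply; rewrite le_eqVlt; apply/orP; left; apply/eqP; ring.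
Qed.

Lemma envelope_step X t e dl : 0 <= t -> 0 <= e -> 0 <= dl ->
  step_const hn * onorm B * e <= dl ->
  envelope X t dl +
    2 * e * (\sum_(Z | boundary X Z) onorm (h Z) * envelope (val Z) t dl) +
    step_const hn * e ^+ 2 * onorm B <= envelope X (t + e) dl.
Proof.
move=> t0 e0 dl0 Me.
set E := expR (2 * s * t); set G := expR ((2 * hn + 1) * t).
have b0 := onorm_ge0 B; have hn0 := hn_ge0; have w0 := weight_ge0 X.
have E1 : 1 <= E by rewrite -expR0 ler_expR !mulr_ge0.
have G1 : 1 <= G by rewrite -expR0 ler_expR mulr_ge0 // addr_ge0 ?mulr_ge0.
(* By [meets_le_weight] the [- 1] in the envelope absorbs the indicator. *)
have envZ (Z : fpowerset Lam) : envelope (val Z) t dl <=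
    2 * onorm B * E * weight (val Z) + dl * G.
  rewrite /envelope -/E -/G lerD2r -[leRHS]mulrA ler_wpM2l ?mulr_ge0 //.
  rewrite mulrBr mulr1 [E * _]mulrC -addrA gerDl addrC subr_le0.
  exact: meets_le_weight.
have S1 : \sum_(Z | boundary X Z) onorm (h Z) * envelope (val Z) t dl <=
    2 * onorm B * E * (s * weight X) + hn * (dl * G).
  apply: (@le_trans _ _ (\sum_(Z | boundary X Z)
      (2 * onorm B * E * (onorm (h Z) * weight (val Z)) + onorm (h Z) * (dl * G)))).
    apply: ler_sum => Z _; apply: le_trans (ler_wpM2l (onorm_ge0 _) (envZ Z)) _.
    by rewrite mulrDr mulrCA.
  rewrite big_split /= -mulr_sumr -mulr_suml; apply: lerD.
    by rewrite ler_wpM2l ?boundary_sum // !mulr_ge0 // (le_trans _ E1).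
  rewrite ler_wpM2r ?mulr_ge0 ?(le_trans _ G1) // [leRHS](bigID (boundary X)) /= lerDl.
  by apply: sumr_ge0 => Z _; exact: onorm_ge0.
have E2 : E * (1 + 2 * s * e) <= expR (2 * s * (t + e)).
  by rewrite [X in expR X]mulrDr expRD ler_wpM2l ?expR_ge0 // expR_ge1Dx.
have G2 : G * (1 + (2 * hn + 1) * e) <= expR ((2 * hn + 1) * (t + e)).
  by rewrite [X in expR X]mulrDr expRD ler_wpM2l ?expR_ge0 // expR_ge1Dx.
rewrite /envelope -/E -/G.
set E' := expR (2 * s * (t + e)) in E2 *; set G' := expR ((2 * hn + 1) * (t + e)) in G2 *.
have l1 : 2 * e * (\sum_(Z | boundary X Z) onorm (h Z) * envelope (val Z) t dl) <=
    2 * e * (2 * onorm B * E * (s * weight X) + hn * (dl * G)).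
  by rewrite ler_wpM2l // mulr_ge0.
have l2 : 2 * onorm B * (weight X * (E * (1 + 2 * s * e))) <= 2 * onorm B * (weight X * E').
  by rewrite ler_wpM2l ?mulr_ge0 // ler_wpM2l.
have l3 : dl * (G * (1 + (2 * hn + 1) * e)) <= dl * G' by rewrite ler_wpM2l.
have l4 : step_const hn * e ^+ 2 * onorm B <= dl * G * e.
  rewrite expr2 mulrA mulrAC ler_wpM2r // mulrAC; apply: le_trans Me _.
  by rewrite ler_peMr.
exact: envelope_arith l1 l2 l3 l4.
Qed.

Lemma envelope_ge0 X t dl : 0 <= t -> 0 <= dl -> 0 <= envelope X t dl.
Proof.
move=> t0 dl0; rewrite /envelope addr_ge0 ?mulr_ge0 ?expR_ge0 ?onorm_ge0 //.
rewrite addr_ge0 ?meets_ge0 // mulr_ge0 ?weight_ge0 // subr_ge0 -expR0 ler_expR.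
by rewrite !mulr_ge0.
Qed.

(** The induction must run over all regions and observables at once: the step uses it for [X] with
    the rotated observable, and for every boundary region [Z] with the observable [h Z]. *)
Lemma discrete_bound X A e dl n : 0 <= e -> e <= 1 -> 0 <= dl ->
  step_const hn * onorm B * e <= dl -> supp X A ->
  onorm (comm (heis H (n%:R * e) A) B) <= envelope X (n%:R * e) dl * onorm A.
Proof.
move=> e0 e1 dl0 Me; elim: n X A => [|n IH] X A XA.
  rewrite mul0r heis0 /envelope !mulr0 expR0 subrr mulr0 add0r mulr1 /meets.
  case: ifPn => XY.
    by rewrite (supp_comm XA B_supp XY) onorm0 mulr0 add0r mulr_ge0 ?onorm_ge0.
  rewrite mulr1 mulrDl; apply: le_trans (onorm_comm _ _) _.
  by rewrite -mulrA [onorm A * _]mulrC mulrA lerDl mulr_ge0 ?onorm_ge0.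
set T := n%:R * e; have T0 : 0 <= T by rewrite mulr_ge0.
have -> : n.+1%:R * e = T + e by rewrite -natr1 mulrDl mul1r.
pose P1 (Z : fpowerset Lam) := val Z `<=` X.
pose H1 := \sum_(Z | P1 Z) h Z.
pose H2 := \sum_(Z | boundary X Z) h Z.
pose H3 := \sum_(Z | ~~ P1 Z && [disjoint val Z & X]%fset) h Z.
have HE : H = H1 + H2 + H3.
  rewrite (bigID P1) /= -addrA; congr (_ + _).
  rewrite (bigID (fun Z : fpowerset Lam => [disjoint val Z & X]%fset)) /= addrC.
  by [].
have H3A : comm H3 A = 0.
  by rewrite comm_suml big1 // => Z /andP[_ ZX]; rewrite (supp_comm (@h_supp Z) XA ZX).
have hH1 : H1 \is hermsymmx by apply: sum_herm => Z _; exact: h_herm.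
have hH2 : H2 \is hermsymmx by apply: sum_herm => Z _; exact: h_herm.
have hH : H \is hermsymmx by apply: sum_herm => Z _; exact: h_herm.
have en : `|e| <= 1 by rewrite ger0_norm.
apply: le_trans (comm_heis_step T B hH hH1 hH2 HE H3A _ _ _ en) _.
- exact: (onorm_partial xpredT).
- exact: onorm_partial.
- exact: onorm_partial.
rewrite (ger0_norm e0).
have a0 := onorm_ge0 A.
have l1 : onorm (comm (heis H T (heis H1 e A)) B) <= envelope X T dl * onorm A.
  apply: le_trans (IH X (heis H1 e A) _) _.
    move=> z zX; apply: off_heis; [exact: hH1| |exact: XA].
    apply: off_sum => Z ZX; apply: h_supp.
    by apply: contra zX; move/fsubsetP: ZX; apply.
  by rewrite ler_wpM2l ?envelope_ge0 ?onorm_heis.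
have l2 : onorm (comm (heis H T H2) B) <=
    \sum_(Z | boundary X Z) onorm (h Z) * envelope (val Z) T dl.
  rewrite heis_sum comm_suml; apply: le_trans (onorm_sum _ _ _) _.
  by apply: ler_sum => Z _; rewrite mulrC; apply: IH; exact: h_supp.
have l3 := envelope_step X T0 e0 dl0 Me.
apply: (@le_trans _ _ (envelope X T dl * onorm A + 2 * onorm A * (e *
   \sum_(Z | boundary X Z) onorm (h Z) * envelope (val Z) T dl) +
   step_const hn * e ^+ 2 * onorm A * onorm B)).
  rewrite lerD2r; apply: lerD => //; rewrite ler_wpM2l ?mulr_ge0 //.
  by rewrite ler_wpM2l.
apply: le_trans (ler_wpM2r a0 l3).
move: (step_const _) (envelope X T dl) (\sum_(Z | _) _) (onorm A) (onorm B).
by move=> c p q a b; rewrite le_eqVlt; apply/orP; left; apply/eqP; ring.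
Qed.

Lemma lieb_robinson X A t : 0 <= t -> supp X A ->
  onorm (comm (heis H t A) B) <=
    2 * onorm B * (weight X * (expR (2 * s * t) - 1) + meets X) * onorm A.
Proof.
move=> t0 XA.
apply: (@ler_linear_limit _ _ _ (expR ((2 * hn + 1) * t) * onorm A) 1) => //.
  by rewrite mulr_ge0 ?expR_ge0 ?onorm_ge0.
move=> dl dl0 _; set M := step_const hn * onorm B.
have M0 : 0 <= M by rewrite mulr_ge0 ?onorm_ge0 ?step_const_ge0 ?hn_ge0.
(* With this many steps the step length [e] satisfies [e * (1 + M / dl) <= 1], which gives both
   [e <= 1] and [M * e <= dl]. *)
pose N := (Num.truncn (t * (1 + M / dl))).+1.
have Nt : t * (1 + M / dl) <= N%:R by rewrite ltW // truncnS_gt.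
have N0 : 0 < N%:R :> R by rewrite ltr0n.
pose e := t / N%:R.
have e0 : 0 <= e by rewrite divr_ge0 // ltW.
have eM : e * (1 + M / dl) <= 1 by rewrite /e mulrAC ler_pdivrMr // mul1r.
have Md : 0 <= M / dl by rewrite divr_ge0 // ltW.
have e1 : e <= 1.
  by apply: le_trans eM; rewrite ler_peMr // lerDl.
have Me : M * e <= dl.
  have : e * (M / dl) <= 1 by apply: le_trans eM; rewrite ler_wpM2l // lerDr.
  by rewrite mulrA ler_pdivrMr // mul1r mulrC.
have := discrete_bound N e0 e1 (ltW dl0) Me XA.
rewrite (_ : N%:R * e = t); last by rewrite /e mulrC divfK // gt_eqF.
move=> /le_trans; apply; rewrite /envelope le_eqVlt; apply/orP; left; apply/eqP.
by rewrite mulrDl; congr (_ + _); rewrite [RHS]mulrC mulrA.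
Qed.

End LiebRobinson.

(** Reduces negative times to positive ones; reversing the sign of every interaction preserves the
    norms that enter the estimate. *)
Lemma heis_opp (R : realType) n (H A : 'M[R[i]]_n) (t : R) :
  H \is hermsymmx -> heis (- H) t A = heis H (- t) A.
Proof.
move=> hH; have hN : - H \is hermsymmx.
  by apply/hermP; rewrite linearN /= map_mxN; move/hermP: hH => ->.
have E (r : R) : expU (- H) r = expU H (- r).
  rewrite -(mexp_herm r hN) -(mexp_herm (- r) hH); congr mexp.
  by rewrite scalerN rmorphN mulrN scaleNr.
by rewrite /heis !E.
Qed.

(** * Distances between regions *)

Section Distance.
Variables (R : realType) (D : nat).
Implicit Types (X Y : {fset site D}) (x y z : site D).

Lemma gdistC x y : gdist x y = gdist y x.
Proof. by rewrite !gdistE; apply: eq_bigr => i _; rewrite distnC. Qed.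

Lemma gdistxx x : gdist x x = 0%N.
Proof. by rewrite gdistE big1 // => i _; rewrite subrr. Qed.

Lemma gdist_triangle x y z : (gdist x z <= gdist x y + gdist y z)%N.
Proof. by rewrite !gdistE -big_split /=; apply: leq_sum => i _; exact: leqD_dist. Qed.

Lemma setdist_le X Y x y : x \in X -> y \in Y -> setdist R X Y <= (gdist x y)%:R.
Proof.
move=> xX yY; apply: ge_inf; last by exists x, y.
by exists 0 => _ [x' [y' [_ _ ->]]]; exact: ler0n.
Qed.

Lemma setdistC X Y : setdist R X Y = setdist R Y X.
Proof.
congr inf; apply/seteqP; split=> r [x [y [xX yY ->]]]; exists y, x; split => //.
  by rewrite gdistC.
by rewrite gdistC.
Qed.

Lemma setdist_gt0_disjoint X Y : 0 < setdist R X Y -> [disjoint X & Y]%fset.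
Proof.
move=> XY0; apply/fdisjointP => x xX; apply/negP => xY.
by have := setdist_le xX xY; rewrite gdistxx leNgt XY0.
Qed.

(** Provides the function [dY] of the comparison argument. Being attained, it dominates [setdist] at
    every site of [X]. *)
Lemma point_distance Y y0 : y0 \in Y -> exists f : site D -> R,
  [/\ forall x z, f x <= f z + (gdist x z)%:R, forall y, y \in Y -> f y <= 0 &
      forall z, exists2 y, y \in Y & f z = (gdist z y)%:R].
Proof.
move=> y0Y.
have mi z : exists2 y, y \in Y & forall y', y' \in Y -> (gdist z y <= gdist z y')%N.
  have [y _ ymin] := @arg_minnP Y [` y0Y] xpredT (fun y : Y => gdist z (val y)) isT.
  by exists (val y); [exact: fsvalP|move=> y' y'Y; exact: (ymin [` y'Y])].
have /choice[m mP] z : exists y, y \in Y /\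
    forall y', y' \in Y -> (gdist z y <= gdist z y')%N.
  by have [y yY yh] := mi z; exists y.
exists (fun z => (gdist z (m z))%:R); split.
- move=> x z; rewrite -natrD ler_nat addnC.
  by apply: leq_trans (gdist_triangle x z (m z)); apply: (mP x).2; exact: (mP z).1.
- by move=> y yY; rewrite -(mulr0n 1) ler_nat; have := (mP y).2 y yY; rewrite gdistxx.
- by move=> z; exists (m z) => //; exact: (mP z).1.
Qed.

End Distance.

(** * Lieb-Robinson bounds from a decaying potential *)

Section DecayingPotential.
Variables (R : realType) (D d k : nat) (C a : R).
Hypotheses (C0 : 0 <= C) (a0 : 0 < a).

(* [k.+1] rather than [k], so that the rate a / (2 k) makes sense for k = 0. *)
Definition LR_speed : R :=
  C * k.+1%:R * ((2 / (1 - expR (- (a / (2 * k.+1%:R))))) ^+ D) ^+ k.+1 + 1.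

(** The summand 1 makes the inequality strict even when [C = 0]. *)
Lemma LR_speed_gt0 : 0 < LR_speed.
Proof.
rewrite /LR_speed ltr_wpDl // mulr_ge0 ?mulr_ge0 ?exprn_ge0 // divr_ge0 // subr_ge0.
by rewrite ltW // expR_lt1 oppr_lt0 divr_gt0 // mulr_gt0.
Qed.

(** Of the rate [a], one half cancels [exp(a / 2 diam)]. The other half equals [b * k.+1], one share
    [b] for each entry of the tuple in [sum_regions_le]. *)
Lemma interaction_sum (Lam : {fset site D}) (Psi : potential_on R d.+1 Lam)
    (h : fpowerset Lam -> op R d.+1 Lam) (x : Lam) :
  kbody_on k Psi ->
  (forall Z : fpowerset Lam, (2 <= #|` val Z|)%N ->
     onorm (Psi Z) <= C * expR (- (a * (diam (val Z))%:R))) ->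
  (forall Z, onorm (h Z) <= onorm (Psi Z)) ->
  \sum_(Z : fpowerset Lam | (val x \in val Z) && (2 <= #|` val Z|)%N)
    onorm (h Z) * (#|` val Z|%:R * expR (a / 2 * (diam (val Z))%:R)) <= LR_speed.
Proof.
move=> kP decay hP; set b := a / (2 * k.+1%:R).
have b0 : 0 < b by rewrite divr_gt0 // mulr_gt0.
have S := sum_regions_le k.+1 x b0.
apply: (@le_trans _ _ (C * k.+1%:R * \sum_(Z : fpowerset Lam |
    (val x \in val Z) && (#|` val Z| <= k.+1)%N) expR (- (b * (k.+1 * diam (val Z))%:R)))).
  rewrite mulr_sumr big_mkcond [leRHS]big_mkcond /=; apply: ler_sum => Z _.
  case: (val x \in val Z) => //=; have [Zk|kZ] := leqP #|` val Z| k.+1; last first.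
    case: ifP => // _; rewrite (_ : onorm (h Z) = 0) ?mul0r //; apply/le_anti.
    by rewrite onorm_ge0 andbT (le_trans (hP Z)) // kP ?onorm0 // ltnW.
  case: ifPn => [Z2|_]; last by rewrite !mulr_ge0 ?expR_ge0.
  rewrite mulrCA -[leRHS]mulrA [leRHS]mulrCA; apply: ler_pM.
  - exact: ler0n.
  - by rewrite mulr_ge0 ?onorm_ge0 ?expR_ge0.
  - by rewrite ler_nat.
  apply: le_trans (ler_wpM2r (expR_ge0 _) (le_trans (hP Z) (decay Z Z2))) _.
  rewrite -[leLHS]mulrA -expRD ler_wpM2l // ler_expR natrM le_eqVlt; apply/orP; left; apply/eqP.
  rewrite /b; field.
  by rewrite addrC natr1 pnatr_eq0.
rewrite /LR_speed -/b; apply: le_trans (ler_wpM2l _ S) _; first by rewrite mulr_ge0.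
by rewrite lerDl.
Qed.

Lemma one_sided_bound (Lam X Y : {fset site D}) (Psi : potential_on R d.+1 Lam)
    (t : R) (A B : op R d.+1 Lam) :
  kbody_on k Psi ->
  (forall Z : fpowerset Lam, (2 <= #|` val Z|)%N ->
     onorm (Psi Z) <= C * expR (- (a * (diam (val Z))%:R))) ->
  supp X A -> supp Y B -> 0 < setdist R X Y -> Y != fset0 ->
  onorm (comm (heis (hamiltonian Psi) t A) B) <=
    2 * ((expR (2 * LR_speed * `|t|) - 1) * #|` X|%:R * expR (- (a / 2 * setdist R X Y))) *
    (onorm A * onorm B).
Proof.
move=> kP decay XA YB XY /fset0Pn[y0 y0Y].
have [f [f_lip f_le0 f_eq]] := point_distance R y0Y.
have a2 : 0 <= a / 2 by rewrite divr_ge0 // ltW.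
(* Stated for a general [h], to be used with the embedded terms for [t >= 0] and with their
   opposites for [t < 0]. *)
have hb (h : fpowerset Lam -> op R d.+1 Lam) : (forall Z, h Z \is hermsymmx) ->
    (forall Z, supp (val Z) (h Z)) -> (forall Z, onorm (h Z) <= onorm (Psi Z)) ->
    onorm (comm (heis (\sum_Z h Z) `|t| A) B) <=
    2 * ((expR (2 * LR_speed * `|t|) - 1) * #|` X|%:R * expR (- (a / 2 * setdist R X Y))) *
    (onorm A * onorm B).
  move=> h_herm h_supp hP.
  have := @lieb_robinson R D d Lam Y h B f (a / 2) LR_speed h_herm h_supp YB f_lip f_le0
    a2 (ltW LR_speed_gt0) (fun x => interaction_sum x kP decay hP) X A `|t| (normr_ge0 t) XA.
  move=> /le_trans; apply.
  rewrite /meets (setdist_gt0_disjoint XY) addr0.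
  have w : weight Lam f (a / 2) X <= #|` X|%:R * expR (- (a / 2 * setdist R X Y)).
    apply: (@le_trans _ _ (\sum_(z in in_region (Lam := Lam) X)
        expR (- (a / 2 * setdist R X Y)))).
      apply: ler_sum => z zX; rewrite ler_expR lerN2 ler_wpM2l //.
      by have [y yY ->] := f_eq (val z); exact: setdist_le.
    by rewrite sumr_const -[leLHS]mulr_natl ler_wpM2r ?expR_ge0 // ler_nat card_in_region.
  have E1 : 0 <= expR (2 * LR_speed * `|t|) - 1.
    by rewrite subr_ge0 -expR0 ler_expR !mulr_ge0 // ltW // LR_speed_gt0.
  move: (onorm_ge0 A) (onorm_ge0 B) w E1.
  move: (weight _ _ _ _) (expR (- _)) (expR _ - 1) (onorm A) (onorm B).
  move=> w ex E al be al0 be0 wle E0.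
  apply: (@le_trans _ _ (2 * be * (#|` X|%:R * ex * E) * al)).
    by rewrite ler_wpM2r // ler_wpM2l ?mulr_ge0 // ler_wpM2r.
  by rewrite le_eqVlt; apply/orP; left; apply/eqP; ring.
have eh (Z : fpowerset Lam) : onorm (embed (fpowerset_sub Z) (Psi Z)) <= onorm (Psi Z).
  exact: onorm_embed [ffun=> ord0].
have [t0|t0] := leP 0 t.
  rewrite -{1}(ger0_norm t0); apply: (hb (fun Z => embed (fpowerset_sub Z) (Psi Z))).
  - by move=> Z; apply: embed_herm; exact: pot_on_herm.
  - by move=> Z; exact: embed_supp.
  - exact: eh.
have -> : heis (hamiltonian Psi) t A =
    heis (\sum_Z - embed (fpowerset_sub Z) (Psi Z)) `|t| A.
  rewrite sumrN (ltr0_norm t0) -/(hamiltonian Psi) heis_opp ?opprK //.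
  exact: hamiltonian_herm.
apply: (hb (fun Z => - embed (fpowerset_sub Z) (Psi Z))).
- move=> Z; rewrite -embedN; apply: embed_herm; apply/hermP.
  by rewrite linearN /= map_mxN; move/hermP: (pot_on_herm Psi Z) => ->.
- by move=> Z; rewrite -embedN; exact: embed_supp.
- by move=> Z; rewrite onormN; exact: eh.
Qed.

Lemma supp0_comm (Lam : {fset site D}) (A B : op R d.+1 Lam) : supp fset0 A -> comm A B = 0.
Proof.
by move=> sA; rewrite /comm (@off_commute _ _ _ _ A B) ?subrr // => z; left; apply: sA.
Qed.

Lemma potential_LR (Lam X Y : {fset site D}) (Psi : potential_on R d.+1 Lam)
    (XL : X `<=` Lam) (YL : Y `<=` Lam) (t : R) (A : op R d.+1 X) (B : op R d.+1 Y) :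
  kbody_on k Psi ->
  (forall Z : fpowerset Lam, (2 <= #|` val Z|)%N ->
     onorm (Psi Z) <= C * expR (- (a * (diam (val Z))%:R))) ->
  let dXY := setdist R X Y in
  let g := if 0 < dXY then expR (2 * LR_speed * `|t|) - 1
           else expR (2 * LR_speed * `|t|) in
  onorm (comm (heis (hamiltonian Psi) t (embed XL A)) (embed YL B)) <=
    2 * Num.min 1 (g * (minn #|` X| #|` Y|)%:R * 1 * expR (- (a / 2 * dXY))) *
    (onorm A * onorm B).
Proof.
move=> kP decay; cbv zeta; set dXY := setdist R X Y; set g := (if _ then _ else _).
set H := hamiltonian Psi.
have b : conf d.+1 Lam := [ffun=> ord0].
have eA : onorm (embed XL A) <= onorm A by exact: onorm_embed b.
have eB : onorm (embed YL B) <= onorm B by exact: onorm_embed b.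
have sA := embed_supp XL A; have sB := embed_supp YL B.
have AB : onorm (embed XL A) * onorm (embed YL B) <= onorm A * onorm B.
  by apply: ler_pM; rewrite ?onorm_ge0.
have AB0 : 0 <= onorm A * onorm B by rewrite mulr_ge0 ?onorm_ge0.
have E1 : 1 <= expR (2 * LR_speed * `|t|).
  by rewrite -expR0 ler_expR !mulr_ge0 // ltW // LR_speed_gt0.
have g0 : 0 <= g by rewrite /g; case: ifP => _; rewrite ?subr_ge0 ?expR_ge0.
have min0 : 0 <= Num.min 1 (g * (minn #|` X| #|` Y|)%:R * 1 * expR (- (a / 2 * dXY))).
  by rewrite le_min ler01 !mulr_ge0 ?expR_ge0.
(* Evolving the commutator back by [- t] exchanges the two observables, which permits a bound by
   either cardinality. *)
have swap : onorm (comm (heis H t (embed XL A)) (embed YL B)) <=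
    onorm (comm (heis H (- t) (embed YL B)) (embed XL A)).
  have -> : comm (heis H t (embed XL A)) (embed YL B) =
      - heis H t (comm (heis H (- t) (embed YL B)) (embed XL A)).
    by rewrite heis_comm -heis_add subrr heis0 -commN.
  by rewrite onormN onorm_heis.
have zero : forall x : R, x <= 0 ->
    x <= 2 * Num.min 1 (g * (minn #|` X| #|` Y|)%:R * 1 * expR (- (a / 2 * dXY))) *
      (onorm A * onorm B).
  by move=> x x0; apply: le_trans x0 _; rewrite mulr_ge0 // mulr_ge0.
(* For an empty region the right-hand side is 0, as the minimum of the cardinalities is; but an
   operator supported nowhere commutes with everything. *)
have [X0|X0] := eqVneq X fset0.
  apply: zero; apply: le_trans swap _.
  rewrite (commN (embed XL A)) supp0_comm ?oppr0 ?onorm0 //.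
  by move: sA; rewrite {1}X0.
have [Y0|Y0] := eqVneq Y fset0.
  apply: zero; rewrite (commN (embed YL B)) supp0_comm ?oppr0 ?onorm0 //.
  by move: sB; rewrite {1}Y0.
have triv : onorm (comm (heis H t (embed XL A)) (embed YL B)) <= 2 * 1 * (onorm A * onorm B).
  apply: le_trans (onorm_comm _ _) _; rewrite mulr1 -mulrA ler_wpM2l //.
  apply: le_trans AB; rewrite ler_wpM2r ?onorm_ge0 //; exact: onorm_heis.
have [dpos|dneg] := ltP 0 dXY; last first.
  rewrite (_ : Num.min _ _ = 1) //; apply: min_l.
  rewrite /g ltNge dneg /= mulr1.
  have m1 : 1 <= (minn #|` X| #|` Y|)%:R :> R.
    by rewrite ler1n leq_min !cardfs_gt0 X0.
  have x1 : 1 <= expR (- (a / 2 * dXY)).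
    by rewrite -expR0 ler_expR oppr_ge0 mulr_ge0_le0 // divr_ge0 // ltW.
  by apply: mulr_ege1 => //; apply: mulr_ege1.
have gE : g = expR (2 * LR_speed * `|t|) - 1 by rewrite /g dpos.
have bX : onorm (comm (heis H t (embed XL A)) (embed YL B)) <=
    2 * (g * #|` X|%:R * 1 * expR (- (a / 2 * dXY))) * (onorm A * onorm B).
  rewrite mulr1 gE; apply: le_trans (one_sided_bound t kP decay sA sB dpos Y0) _.
  by rewrite ler_wpM2l // mulr_ge0 // !mulr_ge0 ?expR_ge0 // subr_ge0.
have bY : onorm (comm (heis H t (embed XL A)) (embed YL B)) <=
    2 * (g * #|` Y|%:R * 1 * expR (- (a / 2 * dXY))) * (onorm A * onorm B).
  apply: le_trans swap _; rewrite /dXY setdistC in dpos *.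
  rewrite mulr1 gE; apply: le_trans (one_sided_bound (- t) kP decay sB sA dpos X0) _.
  rewrite normrN ler_wpM2l //; last by rewrite mulrC.
  by rewrite mulr_ge0 // !mulr_ge0 ?expR_ge0 // subr_ge0.
rewrite /minn; case: ltnP => _; rewrite /Num.min; case: ifP => _ //.
Qed.

End DecayingPotential.

(** The potential may vary with [Lam] as long as [C], [a] and [k] do not. This covers both (a), by
    restricting [Phi], and (c), by the potential of (b). *)
Lemma LR_of_decay (R : realType) (D d k : nat) (Phi : potential R D d.+1) (C a : R) :
  0 <= C -> 0 < a ->
  (forall Lam : {fset site D}, exists Psi : potential_on R d.+1 Lam,
     [/\ hamiltonian Psi = hamiltonian (Defs.restrict Phi Lam), kbody_on k Psi &
      forall Z : fpowerset Lam, (2 <= #|` val Z|)%N ->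
        onorm (Psi Z) <= C * expR (- (a * (diam (val Z))%:R))]) ->
  exists mu v K : R, [/\ 0 < mu, 0 < v, 0 < K & LR_bounds Phi mu v K].
Proof.
move=> C0 a0 hPsi; set s := LR_speed D k C a.
have s0 : 0 < s by exact: LR_speed_gt0.
(* The velocity is chosen so that [mu * v] is the growth rate [2 * s]. *)
exists (a / 2), (2 * s / (a / 2)), 1; split=> //; rewrite ?divr_gt0 ?mulr_gt0 //.
move=> Lam X Y XL YL t; have [Psi [HE kP decay]] := hPsi Lam.
rewrite (_ : a / 2 * (2 * s / (a / 2)) = 2 * s); last first.
  by rewrite mulrC divfK // gt_eqF // divr_gt0.
move=> dXY g; apply/comm_boundP => A B; rewrite -HE.
exact: potential_LR.
Qed.

Theorem mainTheorem2 (R : realType) :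
  [/\ (forall (D d k : nat) (Phi : potential R D d),
         (0 < d)%N -> kbody k Phi -> exp_decaying Phi ->
         exists mu v K : R, [/\ 0 < mu, 0 < v, 0 < K & LR_bounds Phi mu v K]),
      (exists m : nat -> R,
         forall (D d k : nat) (Phi : potential R D d) (mu v K : R),
         (0 < d)%N -> kbody k Phi -> 0 < mu -> 0 < v -> 0 < K ->
         single_site_LR_bounds Phi mu v K ->
         forall Lam : {fset site D},
         exists Psi : potential_on R d Lam,
           [/\ kbody_on k Psi, gives_rise Psi Phi &
               forall X : fpowerset Lam, (2 <= #|` val X|)%N ->
                 opnorm (Psi X) <=
                   m k * (mu * v * K) * expR (- (mu * (diam (val X))%:R))]) &
      (forall (D d k : nat) (Phi : potential R D d) (mu v K : R),
         (0 < d)%N -> kbody k Phi -> 0 < mu -> 0 < v -> 0 < K ->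
         single_site_LR_bounds Phi mu v K ->
         exists mu' v' K' : R,
           [/\ 0 < mu', 0 < v', 0 < K' & LR_bounds Phi mu' v' K'])].
Proof.
split.
(* Writing the dimension as a successor gives ['I_d.+1] its cyclic group structure and a base
   configuration. *)
- move=> D [//|d] k Phi _ kP [K [a [K0 a0 decay]]].
  apply: (LR_of_decay (k := k) (ltW K0) a0) => Lam; exists (Defs.restrict Phi Lam).
  by split=> // [X kX|Z _]; [exact: kP|rewrite -opnormE; exact: decay].
(* One factor 2 for each map [1 - E_x] with [x] in [X], and at most [k] such sites. *)
- exists (fun k => 2 ^+ k) => D [//|d] k Phi mu v K _ kP mu0 v0 K0 LR Lam.
  exists (local_potential Phi Lam); split.
  + exact: kbody_local_potential.
  + by move=> t A; rewrite hamiltonian_local_potential.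
  + by move=> X X2; rewrite opnormE; exact: onorm_local_potential.
- move=> D [//|d] k Phi mu v K _ kP mu0 v0 K0 LR.
  have C0 : 0 <= 2 ^+ k * (mu * v * K) by rewrite mulr_ge0 ?exprn_ge0 // !mulr_ge0 // ltW.
  apply: (LR_of_decay (k := k) C0 mu0) => Lam; exists (local_potential Phi Lam); split.
  + exact: hamiltonian_local_potential.
  + exact: kbody_local_potential.
  + by move=> Z Z2; exact: onorm_local_potential.
Qed.
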